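(* Let $G$ be a graph with $v$ vertices and $\mu$ connected components. Let $\mathcal A$ be a pointed $\mathbb Z$-algebra satisfying the standing assumptions. Then: (a) if $H^{i,j}_{\mathcal A}(G)\ne 0$ then $i+j\ge v-\mu$; (b) if $\mathrm{Tor}(H^{i,j}_{\mathcal A}(G))\neq 0$ then $i+j\ge v-\mu+1$.
   Context: Graphs are finite and undirected, and may have loops and multiple edges. Standing assumptions on $\mathcal A$: $\mathcal A=\bigoplus_{i\ge 0}A_i$ is a commutative graded $\mathbb Z$-algebra with identity such that each $A_i$ is a free $\mathbb Z$-module of finite rank. A graded $\mathbb Z$-algebra $\mathcal A$ is pointed if it has a direct sum decomposition into $\mathbb Z$-submodules $\mathcal A=\mathbb Z1\oplus\mathcal A'$ where all the homogeneous elements of $\mathcal A'$ have degree $\ge 1$. Graph cohomology over $\mathcal A$: let $G$ be a graph with ordered edges $e_1,\dots,e_n$. For $s\subseteq E(G)$ let $[G:s]$ be the graph with vertex set $V(G)$ and edge set $s$, and let $C^{s}(G)=\mathcal A^{\otimes k}$ (tensor over $\mathbb Z$, one factor per connected component of $[G:s]$, $k$ being the number of components), with the induced grading. Put $C^i(G)=\bigoplus_{|s|=i}C^s(G)$. For $e\notin s$ the per-edge map $C^{s}(G)\to C^{s\cup\{e\}}(G)$ is the identity if $e$ joins a component of $[G:s]$ to itself; if $e$ joins two different components it multiplies the two corresponding tensor factors via $\mathcal A\otimes\mathcal A\to\mathcal A$ and is the identity on the other factors. The differential $d^i:C^i(G)\to C^{i+1}(G)$ is the sum of the per-edge maps over all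 $|s|=i$ and $e=e_r\notin s$, with sign $(-1)^{\#\{t<r:\ e_t\in s\}}$. It preserves degree; $H^{i,j}_{\mathcal A}(G)$ is the degree $j$ part of the $i$-th cohomology $H^i_{\mathcal A}(G)$. $\mathrm{Tor}(M)$ denotes the torsion subgroup of an abelian group $M$. *)

(* Defs.v *)
(* Mathematical Components (algebra, generic quotients, free abelian groups),
   with classical logic used only to decide membership in subgroups. *)
From HB Require Import structures.
From mathcomp Require Import all_boot all_algebra.
From mathcomp Require Import boolp freeg.

Set Implicit Arguments.
Unset Strict Implicit.
Unset Printing Implicit Defensive.

Import GRing.Theory.
Local Open Scope ring_scope.
Local Open Scope quotient_scope.

Section ZSpan.
Variables (M : zmodType) (S : M -> Prop).

Definition zspan : {pred M} := fun x =>
  `[< exists2 s : seq (int * M), forall p, p \in s -> S p.2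
      & x = \sum_(p <- s) p.2 *~ p.1 >].

Lemma zspan_closed : zmod_closed zspan.
Proof.
split=> [|x y /asboolP[s Ss ->] /asboolP[t St ->]]; apply/asboolP.
  by exists [::] => //; rewrite big_nil.
exists (s ++ [seq (- p.1, p.2) | p <- t]) => [p|].
  by rewrite mem_cat => /orP[/Ss//|/mapP[q /St Sq ->]].
rewrite big_cat big_map -sumrN; congr (_ + _).
by apply: eq_bigr => p _; rewrite mulrNz.
Qed.

HB.instance Definition _ := GRing.isZmodClosed.Build M zspan zspan_closed.

Lemma mem_zspan x : S x -> x \in zspan.
Proof.
move=> Sx; apply/asboolP; exists [:: (1, x)]; last by rewrite big_seq1.
by move=> p; rewrite inE => /eqP ->.
Qed.

End ZSpan.

Section Tensor.
Variables (I : finType) (M : zmodType).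

Definition upd (a : {ffun I -> M}) (i : I) (x : M) : {ffun I -> M} :=
  [ffun k => if k == i then x else a k].

Definition multiadditive (N : zmodType) (f : {ffun I -> M} -> N) : Prop :=
  forall a i x y, f (upd a i (x + y)) = f (upd a i x) + f (upd a i y).

Definition tensor_rel (z : {freeg {ffun I -> M} / int}) : Prop :=
  exists a i x y, z = << upd a i (x + y) >> - << upd a i x >> - << upd a i y >>.

(* The tensor power of M over int with one factor for each element of I.
   Multiadditivity implies compatibility with integer multiples, so no
   separate relation is needed for scalars. *)
Definition tensor := Quotient.quot (zspan tensor_rel).
HB.instance Definition _ := GRing.Zmodule.on tensor.

Definition pure (a : {ffun I -> M}) : tensor :=
  \pi_(Quotient.quot (zspan tensor_rel)) << a >>.

Section Lift.
Variables (N : zmodType) (f : {ffun I -> M} -> N).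

Definition freeg_lift : {freeg {ffun I -> M} / int} -> N :=
  @fglift int (zmodule N) {ffun I -> M} f.

Lemma freeg_lift_is_zmod_morphism : zmod_morphism freeg_lift.
Proof. exact: (@lift_is_additive int _ (zmodule N) f). Qed.

HB.instance Definition _ :=
  GRing.isZmodMorphism.Build {freeg {ffun I -> M} / int} N freeg_lift
    freeg_lift_is_zmod_morphism.

Lemma freeg_lift1 a : freeg_lift << a >> = f a.
Proof. by rewrite /freeg_lift liftU scale1r. Qed.

Definition tensor_lift (_ : multiadditive f) (t : tensor) : N :=
  freeg_lift (repr t).

Variable fM : multiadditive f.

Lemma freeg_lift_rel z : z \in zspan tensor_rel -> freeg_lift z = 0.
Proof.
move=> /asboolP[s Ss ->]; rewrite raddf_sum big_seq big1 // => p /Ss.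
case=> [a [i [x [y ->]]]]; rewrite raddfMz !raddfB /= !freeg_lift1 fM.
by rewrite addrAC addrK subrr mul0rz.
Qed.

Lemma tensor_lift_pi z :
  tensor_lift fM (\pi_(Quotient.quot (zspan tensor_rel)) z) = freeg_lift z.
Proof.
apply/eqP; rewrite -subr_eq0 -raddfB; apply/eqP/freeg_lift_rel.
by rewrite Quotient.idealrBE reprK.
Qed.

Lemma tensor_lift_is_zmod_morphism : zmod_morphism (tensor_lift fM).
Proof.
move=> x y; rewrite -[x]reprK -[y]reprK -pi_is_zmod_morphism.
by rewrite !tensor_lift_pi raddfB.
Qed.

HB.instance Definition _ :=
  GRing.isZmodMorphism.Build tensor N (tensor_lift fM)
    tensor_lift_is_zmod_morphism.

Lemma tensor_lift_pure a : tensor_lift fM (pure a) = f a.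
Proof. by rewrite tensor_lift_pi freeg_lift1. Qed.

End Lift.

Lemma pure_multiadditive : multiadditive pure.
Proof.
move=> a i x y; rewrite /pure -raddfD; apply/eqP.
rewrite -Quotient.idealrBE opprD addrA mem_zspan //.
by exists a, i, x, y.
Qed.

End Tensor.

Section TensorAlgebra.
Variable A : comPzRingType.

Lemma pushforward_multiadditive (I J : finType) (h : I -> J) :
  multiadditive (fun a : {ffun I -> A} =>
    pure [ffun j => \prod_(i | h i == j) a i]).
Proof.
move=> a i x y; set b := [ffun j => \prod_(k | h k == j) a k].
pose c := \prod_(k | (h k == h i) && (k != i)) a k.
suff E z : [ffun j => \prod_(k | h k == j) upd a i z k] = upd b (h i) (z * c).
  by rewrite !E mulrDl pure_multiadditive.
apply/ffunP => j; rewrite !ffunE; case: eqVneq => [->|njhi].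
  rewrite (bigD1 i) //= ffunE eqxx; congr (_ * _).
  by apply: eq_bigr => k /andP[_ /negPf nki]; rewrite ffunE nki.
apply: eq_bigr => k /eqP hk; rewrite ffunE; case: eqP => // ki.
by rewrite -hk ki eqxx in njhi.
Qed.

(* Multiplies together the tensor factors lying over each j : J:
   (x)_i a_i |-> (x)_j \prod_(h i = j) a_i. *)
Definition pushforward (I J : finType) (h : I -> J) :
    tensor I A -> tensor J A :=
  tensor_lift (pushforward_multiadditive h).

HB.instance Definition _ (I J : finType) (h : I -> J) :=
  GRing.isZmodMorphism.Build (tensor I A) (tensor J A) (pushforward h)
    (tensor_lift_is_zmod_morphism (pushforward_multiadditive h)).

Lemma pushforward_pure (I J : finType) (h : I -> J) (a : {ffun I -> A}) :
  pushforward h (pure a) = pure [ffun j => \prod_(i | h i == j) a i].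
Proof. exact: tensor_lift_pure. Qed.

Variable A_ : nat -> {pred A}.

Definition tensor_deg (I : finType) (j : nat) : {pred tensor I A} :=
  zspan (fun z => exists a : {ffun I -> A}, exists k : {ffun I -> nat},
    [/\ forall i, a i \in A_ (k i), (\sum_i k i)%N = j & z = pure a]).

HB.instance Definition _ (I : finType) (j : nat) :=
  GRing.ZmodClosed.on (@tensor_deg I j).

Definition free_of_finite_rank (S : {pred A}) : Prop :=
  exists r (b : 'I_r -> A), (forall k, b k \in S) /\
    forall x, x \in S -> exists! c : {ffun 'I_r -> int}, x = \sum_k b k *~ c k.

Record graded_algebra : Prop := GradedAlgebra {
  graded_closed : forall i, zmod_closed (A_ i);
  graded_one : 1 \in A_ 0%N;
  graded_mul : forall i j x y, x \in A_ i -> y \in A_ j -> x * y \in A_ (i + j)%N;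
  graded_span : forall x, exists n (f : 'I_n -> A),
    (forall i, f i \in A_ i) /\ x = \sum_i f i;
  graded_direct : forall n (f : 'I_n -> A),
    (forall i, f i \in A_ i) -> \sum_i f i = 0 -> forall i, f i = 0;
  graded_free : forall i, free_of_finite_rank (A_ i)
}.

(* Zero is homogeneous of every degree, hence the condition a != 0. *)
Definition pointed : Prop :=
  exists A' : {pred A},
    [/\ zmod_closed A',
        forall x, exists m : int, exists2 a, a \in A' & x = m%:~R + a,
        forall m : int, (m%:~R : A) \in A' -> (m%:~R : A) = 0
      & forall j a, a \in A' -> a \in A_ j -> a != 0 -> (1 <= j)%N].

End TensorAlgebra.

(* Each edge is listed with its two endpoints; the order of the pair plays no
   role below.  Equal endpoints give a loop, and repeated pairs give multiple
   edges.  The edges are ordered as 'I_(nedges G). *)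
Record mgraph := MGraph {
  vertex : finType;
  nedges : nat;
  ends : 'I_nedges -> vertex * vertex
}.

Section Graph.
Variable G : mgraph.
Local Notation V := (vertex G).
Local Notation E := 'I_(nedges G).

Definition adj (s : {set E}) : rel V :=
  fun x y => [exists e in s, (ends e == (x, y)) || (ends e == (y, x))].

Definition ncomponents (s : {set E}) : nat := n_comp (adj s) predT.

(* A connected component of the spanning subgraph [G : s] is represented by its
   canonical vertex. *)
Definition component (s : {set E}) := {x : V | x \in fingraph.roots (adj s)}.
HB.instance Definition _ s := Finite.on (component s).

Lemma adj_connect_sym s : connect_sym (adj s).
Proof.
apply: sym_connect_sym => x y; rewrite /adj.
by apply: eq_existsb => e; rewrite orbC.
Qed.

Definition component_of (s : {set E}) (x : V) : component s :=
  exist _ (fingraph.root (adj s) x) (roots_root (@adj_connect_sym s) x).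

Lemma component_ofE s (c : component s) : component_of s (val c) = c.
Proof. by case: c => x /= xr; apply/val_inj/eqP. Qed.

Lemma eq_component_of s x y :
  (component_of s x == component_of s y) = connect (adj s) x y.
Proof. exact: root_connect (@adj_connect_sym s) x y. Qed.

Lemma connect_adjU1 s e x y u v : ends e = (x, y) ->
  connect (adj (e |: s)) u v =
  [|| connect (adj s) u v, connect (adj s) u x && connect (adj s) y v
    | connect (adj s) u y && connect (adj s) x v].
Proof.
move=> exy; have csym := @adj_connect_sym s.
have sub a b : connect (adj s) a b -> connect (adj (e |: s)) a b.
  apply: connect_sub => {}a {}b /existsP[f /andP[fs Hf]].
  by apply/connect1/existsP; exists f; rewrite inE fs orbT.
have xy : connect (adj (e |: s)) x y.
  by apply/connect1/existsP; exists e; rewrite !inE eqxx exy /= eqxx.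
apply/idP/idP => [/connectP[p]|]; last first.
  case/or3P => [/sub//|/andP[/sub ux /sub yv]|/andP[/sub uy /sub xv]].
    exact: connect_trans (connect_trans ux xy) yv.
  rewrite adj_connect_sym in xy.
  exact: connect_trans (connect_trans uy xy) xv.
elim: p u => /= [|w p IH] u; first by move=> _ ->; rewrite connect0.
case/andP => uw /IH{}IH /IH{IH}; case/existsP: uw => f /andP[].
rewrite !inE => /orP[/eqP->|fs Hf]; last first.
  have uw : connect (adj s) u w by apply/connect1/existsP; exists f; rewrite fs.
  case/or3P => [wv|/andP[wx yv]|/andP[wy xv]]; apply/or3P.
  - by constructor 1; apply: connect_trans uw wv.
  - by constructor 2; rewrite (connect_trans uw wx).
  - by constructor 3; rewrite (connect_trans uw wy).
rewrite exy !xpair_eqE => /orP[]/andP[/eqP<- /eqP<-].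
  case/or3P => [->|/andP[_ ->]|/andP[_ ->]] //; by rewrite connect0 ?orbT.
case/or3P => [->|/andP[_ ->]|/andP[_ ->]] //; by rewrite connect0 ?orbT.
Qed.

End Graph.

Section DirectSum.
Variables (I : finType) (M : I -> zmodType).

Definition dsum := {dffun forall i, M i}.
HB.instance Definition _ := Choice.on dsum.

Let zero : dsum := [ffun i => 0].
Let opp (x : dsum) : dsum := [ffun i => - x i].
Let add (x y : dsum) : dsum := [ffun i => x i + y i].

Fact dsum_addA : associative add.
Proof. by move=> x y z; apply/ffunP => i; rewrite !ffunE addrA. Qed.
Fact dsum_addC : commutative add.
Proof. by move=> x y; apply/ffunP => i; rewrite !ffunE addrC. Qed.
Fact dsum_add0 : left_id zero add.
Proof. by move=> x; apply/ffunP => i; rewrite !ffunE add0r. Qed.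
Fact dsum_addN : left_inverse zero opp add.
Proof. by move=> x; apply/ffunP => i; rewrite !ffunE addNr. Qed.

HB.instance Definition _ :=
  GRing.isZmodule.Build dsum dsum_addA dsum_addC dsum_add0 dsum_addN.

End DirectSum.

Section Cohomology.
Variables (A : comPzRingType) (A_ : nat -> {pred A}) (G : mgraph).
Local Notation E := 'I_(nedges G).

Definition edge_sets (i : nat) := {s : {set E} | #|s| == i}.
HB.instance Definition _ i := Finite.on (edge_sets i).

Definition state (s : {set E}) : zmodType := tensor (component s) A.

Definition cochain (i : nat) := dsum (fun s : edge_sets i => state (val s)).
HB.instance Definition _ i := GRing.Zmodule.on (cochain i).

(* This is the per-edge map when t = e |: s: every component of [G : s] goes to
   the component of [G : t] containing it.  The two cases, according to whether
   e joins a component to itself or joins two distinct components, are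
   edge_map_loop and edge_map_join. *)
Definition edge_map (s t : {set E}) : state s -> state t :=
  pushforward (fun c : component s => component_of t (val c)).

HB.instance Definition _ (s t : {set E}) :=
  GRing.Additive.on (@edge_map s t).

Lemma edge_map_loop (s : {set E}) (e : E) (x y : vertex G)
    (a : {ffun component s -> A}) :
  ends e = (x, y) -> component_of s x = component_of s y ->
  edge_map (e |: s) (pure a) = pure [ffun c => a (component_of s (val c))].
Proof.
move=> exy /eqP; rewrite eq_component_of => cxy.
rewrite /edge_map pushforward_pure; congr pure; apply/ffunP => c; rewrite !ffunE.
apply: big_pred1 => b /=.
rewrite -{1}[c]component_ofE -{2}[b]component_ofE !eq_component_of.
rewrite (connect_adjU1 _ _ _ exy); apply/idP/idP => [|-> //].
have cyx : connect (adj s) y x by rewrite adj_connect_sym.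
case/or3P => // /andP[bx xc].
  exact: connect_trans (connect_trans bx cxy) xc.
exact: connect_trans (connect_trans bx cyx) xc.
Qed.

Lemma edge_map_join (s : {set E}) (e : E) (x y : vertex G)
    (a : {ffun component s -> A}) :
  ends e = (x, y) -> component_of s x != component_of s y ->
  edge_map (e |: s) (pure a) = pure [ffun c =>
    if c == component_of (e |: s) x
    then a (component_of s x) * a (component_of s y)
    else a (component_of s (val c))].
Proof.
move=> exy nxy; have ct := connect_trans.
rewrite /edge_map pushforward_pure; congr pure; apply/ffunP => c; rewrite !ffunE.
set z := val c; have cz : component_of (e |: s) z = c by rewrite component_ofE.
have E1 (b : component s) w : (component_of (e |: s) (val b) == component_of (e |: s) w)
    = [|| b == component_of s w, (b == component_of s x) && (component_of s y == component_of s w)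
      | (b == component_of s y) && (component_of s x == component_of s w)].
  rewrite eq_component_of (connect_adjU1 _ _ _ exy) -!eq_component_of.
  by rewrite component_ofE.
case: ifPn => [/eqP->|].
  rewrite (bigD1 (component_of s x)); last by rewrite E1 eqxx.
  congr (_ * _); apply: big_pred1 => b.
  rewrite E1 eqxx andbT [component_of s y == _]eq_sym (negPf nxy) andbF /=.
  case: eqVneq => [->|_] /=; first by rewrite (negPf nxy).
  by rewrite andbT.
rewrite -cz eq_component_of adj_connect_sym (connect_adjU1 _ _ _ exy) connect0.
rewrite -!eq_component_of => nz; apply: big_pred1 => b; rewrite E1.
move: nz; rewrite !(eq_sym _ (component_of s z)).
by do 2!case: (component_of s z == _) => //=; rewrite ?andbF ?orbF.
Qed.

Definition edge_sign (s : {set E}) (e : E) : int :=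
  (-1) ^+ #|[set f in s | (f < e)%N]|.

Definition differential (i : nat) (x : cochain i) : cochain i.+1 :=
  [ffun t : edge_sets i.+1 =>
    \sum_(s : edge_sets i) \sum_(e | (e \notin val s) && (val t == e |: val s))
      edge_map (val t) (x s) *~ edge_sign (val s) e].

Lemma differential_is_zmod_morphism i : zmod_morphism (@differential i).
Proof.
move=> x y; apply/ffunP => t; rewrite !ffunE -sumrN -big_split.
apply: eq_bigr => s _; rewrite -sumrN -big_split; apply: eq_bigr => e _.
by rewrite !ffunE raddfB mulrzBl.
Qed.

HB.instance Definition _ i :=
  GRing.isZmodMorphism.Build (cochain i) (cochain i.+1) (@differential i)
    (@differential_is_zmod_morphism i).

Definition cocycles (i : nat) : {pred cochain i} :=
  fun x => differential x == 0.

Lemma cocycles_closed i : zmod_closed (@cocycles i).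
Proof.
split=> [|x y /eqP dx /eqP dy]; apply/eqP; first exact: raddf0.
have /= -> := raddfB (@differential i) x y.
by rewrite dx dy subrr.
Qed.

HB.instance Definition _ i :=
  GRing.isZmodClosed.Build (cochain i) (@cocycles i) (@cocycles_closed i).

Definition cocycle (i : nat) := {x : cochain i | x \in @cocycles i}.
HB.instance Definition _ i := SubChoice.on (cocycle i).
HB.instance Definition _ i := [SubChoice_isSubZmodule of cocycle i by <:].

Definition is_coboundary (i : nat) : cochain i -> Prop :=
  match i with
  | 0 => fun x => x = 0
  | k.+1 => fun x => exists y : cochain k, x = differential y
  end.

Definition coboundaries (i : nat) : {pred cocycle i} :=
  fun z => `[< is_coboundary (val z) >].

Lemma coboundaries_closed i : zmod_closed (@coboundaries i).
Proof.
case: i => [|i]; split.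
- exact/asboolP.
- move=> x y /asboolP x0 /asboolP y0; apply/asboolP.
  by rewrite /is_coboundary /= in x0 y0 *; rewrite x0 y0 subrr.
- by apply/asboolP; exists 0; rewrite [RHS]raddf0.
- move=> x y /asboolP[u xu] /asboolP[v yv]; apply/asboolP; exists (u - v).
  by rewrite [RHS]raddfB; congr (_ - _).
Qed.

HB.instance Definition _ i :=
  GRing.isZmodClosed.Build (cocycle i) (@coboundaries i)
    (@coboundaries_closed i).

Definition cohomology (i : nat) := Quotient.quot (@coboundaries i).
HB.instance Definition _ i := GRing.Zmodule.on (cohomology i).

Definition cochain_deg (i j : nat) : {pred cochain i} :=
  fun x => [forall s, x s \in tensor_deg A_ j].

Definition cohomology_class i (z : cocycle i) : cohomology i :=
  \pi_(Quotient.quot (@coboundaries i)) z.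

Definition cohomology_deg (i j : nat) : {pred cohomology i} := fun h =>
  `[< exists2 z : cocycle i, val z \in @cochain_deg i j
      & h = cohomology_class z >].

Lemma cohomology_deg_closed i j : zmod_closed (@cohomology_deg i j).
Proof.
split=> [|h k /asboolP[z zj ->] /asboolP[w wj ->]]; apply/asboolP.
  exists 0; last by rewrite /cohomology_class raddf0.
  by apply/forallP => s; rewrite ffunE rpred0.
exists (z - w); last by rewrite /cohomology_class raddfB.
apply/forallP => s; rewrite !ffunE.
by rewrite rpredB ?(forallP zj) ?(forallP wj).
Qed.

HB.instance Definition _ i j :=
  GRing.isZmodClosed.Build (cohomology i) (@cohomology_deg i j)
    (@cohomology_deg_closed i j).

Definition graph_cohomology (i j : nat) :=
  {h : cohomology i | h \in @cohomology_deg i j}.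
HB.instance Definition _ i j := SubChoice.on (graph_cohomology i j).
HB.instance Definition _ i j :=
  [SubChoice_isSubZmodule of graph_cohomology i j by <:].

End Cohomology.

Definition torsion (M : zmodType) : {pred M} :=
  fun x => `[< exists2 n : nat, (0 < n)%N & x *+ n = 0 >].
Arguments torsion : clear implicits.

(* Main.v *)
(* The cochains indexed by the edge sets s with P <= s <= Q form a complex that
   computes, up to a shift by |P|, the cohomology of the graph obtained from G
   by deleting the edges outside Q and contracting those of P.  By induction on
   |Q - P| we bound the degrees where it has cohomology or torsion, in terms of
   the numbers k(P) and k(Q) of components.

   If some e in Q - P is not a bridge of Q, deleting e does not change k(Q) and
   contracting it lowers k(P) by at most one, so the long exact sequence of
   [P + e, Q], [P, Q] and [P, Q - e] gives the bounds.  If all edges of Q - P are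
   bridges, Q is a forest over P.  For a leaf x attached by e, inserting 1 at x
   is a section of the edge map of e compatible with the other edges; hence
   there is no cohomology above the bottom index.  The bottom cohomology is
   torsion-free, as a subgroup of a tensor power of A, and vanishes in small
   degrees: since A_0 = Z1, a homogeneous pure tensor of degree less than
   |Q - P| has a scalar factor at some non-root vertex, and it is killed by a
   projection onto the common kernel of the edge maps. *)
Require Import Defs.
From HB Require Import structures.
From mathcomp Require Import all_boot all_algebra.
From mathcomp Require Import boolp freeg.

Set Implicit Arguments.
Unset Strict Implicit.
Unset Printing Implicit Defensive.

Import GRing.Theory Num.Theory.
Local Open Scope ring_scope.

(** * Tensor powers *)

Section ZSpanTheory.
Variables (M N : zmodType) (S : M -> Prop).

Lemma zspan_sub (K : zmodClosed M) :
  (forall x, S x -> x \in K) -> {subset zspan S <= K}.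
Proof.
move=> SK x /asboolP[s Ss ->]; rewrite big_seq.
by apply: rpred_sum => p /Ss/SK; exact: rpredMz.
Qed.

Lemma zspan_morph (T : N -> Prop) (f : {additive M -> N}) x :
  (forall y, S y -> f y \in zspan T) -> x \in zspan S -> f x \in zspan T.
Proof.
move=> ST /asboolP[s Ss ->]; rewrite raddf_sum big_seq.
by apply: rpred_sum => p /Ss/ST; rewrite raddfMz; exact: rpredMz.
Qed.

Lemma zspan_eq (f g : {additive M -> N}) x :
  (forall y, S y -> f y = g y) -> x \in zspan S -> f x = g x.
Proof.
move=> fg /asboolP[s Ss ->]; rewrite !raddf_sum !big_seq.
by apply: eq_bigr => p /Ss/fg fgp; rewrite !raddfMz fgp.
Qed.

Lemma zspan_eq0 (f : {additive M -> N}) x :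
  (forall y, S y -> f y = 0) -> x \in zspan S -> f x = 0.
Proof.
move=> f0 /asboolP[s Ss ->]; rewrite raddf_sum big_seq big1 // => p /Ss/f0.
by rewrite raddfMz => ->; rewrite mul0rz.
Qed.

End ZSpanTheory.

Lemma zspanS (M : zmodType) (S T : M -> Prop) :
  (forall x, S x -> T x) -> {subset zspan S <= zspan T}.
Proof. by move=> ST; apply: zspan_sub => x /ST; exact: mem_zspan. Qed.

Section TensorTheory.
Variables (I : finType) (M : zmodType).
Implicit Type a : {ffun I -> M}.

Lemma upd_id a i : upd a i (a i) = a.
Proof. by apply/ffunP => k; rewrite ffunE; case: eqP => // ->. Qed.

(** Freezing all factors except the one at [i] turns multiadditivity of [pure] into an additive map
    of one variable. *)
Definition pure_at a i (x : M) : tensor I M := pure (upd a i x).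

Lemma pure_at_is_zmod_morphism a i : zmod_morphism (pure_at a i).
Proof.
move=> x y; apply/eqP; rewrite eq_sym subr_eq; apply/eqP.
by rewrite /pure_at -pure_multiadditive subrK.
Qed.

HB.instance Definition _ a i :=
  GRing.isZmodMorphism.Build M (tensor I M) (pure_at a i)
    (pure_at_is_zmod_morphism a i).

Definition pure_of (S : I -> M -> Prop) (z : tensor I M) : Prop :=
  exists2 a : {ffun I -> M}, forall i, S i (a i) & z = pure a.

Lemma pure_zspan a (S : I -> M -> Prop) :
  (forall i, a i \in zspan (S i)) -> pure a \in zspan (pure_of S).
Proof.
move=> aS.
(* The list [s] holds the indices whose factors still have to be expanded. *)
suff H (s : seq I) : forall a, (forall i, a i \in zspan (S i)) ->
    (forall i, i \notin s -> S i (a i)) ->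
    pure a \in zspan (pure_of S).
  by apply: (H (enum I)) => // i; rewrite mem_enum.
elim: s => [|i s IH] {aS}a aS aN.
  by apply: mem_zspan; exists a => // i; exact: aN.
have E : pure a = pure_at a i (a i).
  by rewrite /pure_at upd_id.
rewrite E; apply: zspan_morph (aS i) => y Sy; apply: IH => k.
  rewrite ffunE; case: eqP => [->|_]; last exact: aS.
  exact: mem_zspan.
rewrite ffunE; case: eqP => [-> //|/eqP ki ks].
by apply: aN; rewrite inE negb_or ki.
Qed.

Lemma tensor_zspan (x : tensor I M) :
  x \in zspan (fun z => exists a, z = pure a).
Proof.
rewrite -[x]reprK -[repr x]freeg_sumE raddf_sum; apply: rpred_sum => a _.
have -> : << coeff a (repr x) *g a >> = << a >> *~ coeff a (repr x)
    :> {freeg {ffun I -> M} / int}.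
  by rewrite freegU_mulz intz.
by rewrite raddfMz; apply/rpredMz/mem_zspan; exists a.
Qed.

Lemma tensor_ext (N : zmodType) (f g : {additive tensor I M -> N}) :
  (forall a, f (pure a) = g (pure a)) -> f =1 g.
Proof. by move=> fg x; apply: zspan_eq (tensor_zspan x) => y [a ->]. Qed.

End TensorTheory.

Section PushforwardTheory.
Variable A : comPzRingType.

Lemma pushforward_comp (I J K : finType) (h : I -> J) (g : J -> K)
    (x : tensor I A) :
  pushforward g (pushforward h x) = pushforward (g \o h) x.
Proof.
apply: (@tensor_ext I A _ (pushforward g \o pushforward h)) => a /=.
rewrite !pushforward_pure; congr pure; apply/ffunP => k; rewrite !ffunE.
rewrite (partition_big h (fun j => g j == k)) //=.
apply: eq_bigr => j /eqP gj; rewrite ffunE; apply: eq_bigl => i.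
by case: (eqVneq (h i) j) => [->|]; rewrite ?andbF // gj eqxx.
Qed.

Lemma eq_pushforward (I J : finType) (h g : I -> J) (x : tensor I A) :
  h =1 g -> pushforward h x = pushforward g x.
Proof.
move=> hg; apply: (@tensor_ext I A _ (pushforward h) (pushforward g)) => a /=.
rewrite !pushforward_pure; congr pure.
by apply/ffunP => j; rewrite !ffunE; apply: eq_bigl => i; rewrite hg.
Qed.

Lemma pushforward_id (I : finType) (x : tensor I A) : pushforward id x = x.
Proof.
apply: (@tensor_ext I A _ (pushforward id) idfun) => a /=.
rewrite pushforward_pure; congr pure; apply/ffunP => i.
by rewrite ffunE big_pred1_eq.
Qed.

End PushforwardTheory.

(** * Graded algebras and homogeneous bases *)

Section GradedAlgebra.
Variables (A : comPzRingType) (A_ : nat -> {pred A}).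
Hypothesis hA : graded_algebra A_.

Let gr0 i : 0 \in A_ i := (graded_closed hA i).1.
Let grB i x y : x \in A_ i -> y \in A_ i -> x - y \in A_ i :=
  (graded_closed hA i).2 x y.

Definition decomposes (x : A) (f : nat -> A) : Prop :=
  (forall i, f i \in A_ i) /\
  exists n, (forall i, (n <= i)%N -> f i = 0) /\ x = \sum_(i < n) f i.

Lemma decomposes_widen x f n m : (forall i, (n <= i)%N -> f i = 0) ->
  x = \sum_(i < n) f i :> A -> (n <= m)%N -> x = \sum_(i < m) f i.
Proof.
move=> f0 -> nm; rewrite (big_ord_widen m (fun i => f i)) // big_mkcond /=.
by apply: eq_bigr => i _; case: ltnP => // /f0.
Qed.

Lemma decomposesB x y f g : decomposes x f -> decomposes y g ->
  decomposes (x - y) (fun i => f i - g i).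
Proof.
move=> [fA [n [fn xE]]] [gA [m [gm yE]]]; split=> [i|]; first exact: grB.
exists (maxn n m); split=> [i|].
  by rewrite geq_max => /andP[/fn-> /gm->]; rewrite subr0.
rewrite (decomposes_widen fn xE (leq_maxl n m)).
by rewrite (decomposes_widen gm yE (leq_maxr n m)) sumrB.
Qed.

Lemma decomposes0 f : decomposes 0 f -> forall i, f i = 0.
Proof.
move=> [fA [n [fn s0]]] i; case: (leqP n i) => [/fn//|ltin].
exact: (@graded_direct _ _ hA n (fun i => f i) (fun i => fA i) (esym s0)
  (Ordinal ltin)).
Qed.

Lemma decomposes_uniq x f g : decomposes x f -> decomposes x g -> f =1 g.
Proof.
move=> xf xg i; have := decomposesB xf xg; rewrite subrr.
by move=> /decomposes0/(_ i)/eqP; rewrite subr_eq0 => /eqP.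
Qed.

Lemma decomposes_homogeneous x i : x \in A_ i ->
  decomposes x (fun k => if k == i then x else 0).
Proof.
move=> xi; split=> [k|]; first by case: eqP => [->|_].
exists i.+1; split=> [k|]; first by case: eqP => // ->; rewrite ltnn.
by rewrite -big_mkcond (big_pred1 ord_max).
Qed.

Lemma decomposition x : {f | decomposes x f}.
Proof.
apply: cid; have [n [f [fA ->]]] := graded_span hA x.
exists (fun i => oapp f 0 (insub i)); split=> [i|].
  by case: insubP => [u _ <-|_] /=; [exact: fA | exact: gr0].
exists n; split=> [i ni|]; first by rewrite insubF // ltnNge ni.
by apply: eq_bigr => i _; rewrite valK.
Qed.

Definition gproj i x := sval (decomposition x) i.

Lemma gproj_is_zmod_morphism i : zmod_morphism (gproj i).
Proof.
move=> x y; rewrite /gproj; case: (decomposition x) => f xf.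
case: (decomposition y) => g yg; case: (decomposition (x - y)) => h xyh /=.
exact: decomposes_uniq xyh (decomposesB xf yg) i.
Qed.

HB.instance Definition _ i :=
  GRing.isZmodMorphism.Build A A (gproj i) (gproj_is_zmod_morphism i).

Lemma gproj_in i x : gproj i x \in A_ i.
Proof. by rewrite /gproj; case: (decomposition x) => f [fA _] /=. Qed.

Lemma gprojE i k x : x \in A_ i -> gproj k x = if k == i then x else 0.
Proof.
move=> xi; rewrite /gproj; case: (decomposition x) => f xf /=.
exact: decomposes_uniq xf (decomposes_homogeneous xi) k.
Qed.

Lemma gproj_sum x : exists n, x = \sum_(i < n) gproj i x.
Proof.
by rewrite /gproj; case: (decomposition x) => f [? [n [? xE]]] /=; exists n.
Qed.

Definition grank l := sval (cid (graded_free hA l)).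
Definition gbasis l : 'I_(grank l) -> A := sval (cid (svalP (cid (graded_free hA l)))).

Lemma gbasis_in l (k : 'I_(grank l)) : gbasis k \in A_ l.
Proof. exact: (svalP (cid (svalP (cid (graded_free hA l))))).1. Qed.

Lemma gcoord_ex l x : {c : {ffun 'I_(grank l) -> int} |
  gproj l x = \sum_k gbasis k *~ c k}.
Proof.
apply: cid.
have [c [cx _]] := (svalP (cid (svalP (cid (graded_free hA l))))).2
  _ (gproj_in l x).
by exists c.
Qed.

Lemma gbasis_free l (c d : {ffun 'I_(grank l) -> int}) :
  \sum_k gbasis k *~ c k = \sum_k gbasis k *~ d k -> c = d.
Proof.
move=> cd; have [_ fr] := svalP (cid (svalP (cid (graded_free hA l)))).
(* Uniqueness of coordinates is granted only for elements of [A_ l]; the sum lies there because it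
   equals its own projection. *)
have xA : \sum_k gbasis k *~ c k \in A_ l.
  have /= -> // : \sum_k gbasis k *~ c k = gproj l (\sum_k gbasis k *~ c k).
    rewrite raddf_sum; apply: eq_bigr => k _; rewrite raddfMz /=.
    by rewrite (gprojE l (gbasis_in k)) eqxx.
  exact: gproj_in.
have [e [_ eU]] := fr _ xA.
by rewrite -(eU c (erefl _)) (eU d cd).
Qed.

Definition gcoord l (k : 'I_(grank l)) x := sval (gcoord_ex l x) k.

Lemma gcoordE l x : gproj l x = \sum_(k < grank l) gbasis k *~ gcoord k x.
Proof. exact: svalP (gcoord_ex l x). Qed.

Lemma gcoord_is_zmod_morphism l (k : 'I_(grank l)) : zmod_morphism (@gcoord l k).
Proof.
move=> x y; suff /ffunP/(_ k) : [ffun k => @gcoord l k (x - y)] =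
   [ffun k => gcoord k x - gcoord k y] by rewrite !ffunE.
apply: gbasis_free; under eq_bigr do rewrite ffunE; rewrite -gcoordE raddfB /=.
rewrite 2!gcoordE -sumrB; apply: eq_bigr => i _.
by rewrite ffunE mulrzBr.
Qed.

HB.instance Definition _ l k :=
  GRing.isZmodMorphism.Build A int (@gcoord l k) (@gcoord_is_zmod_morphism l k).

Lemma gcoord_homogeneous l k m x : x \in A_ m -> m != l -> @gcoord l k x = 0.
Proof.
move=> xm ml; suff /ffunP/(_ k) : [ffun k => @gcoord l k x] = [ffun=> 0].
  by rewrite !ffunE.
apply: gbasis_free; under eq_bigr do rewrite ffunE.
rewrite -gcoordE (gprojE l xm) eq_sym (negPf ml) big1 // => i _.
by rewrite ffunE mulr0z.
Qed.

Lemma gcoord_basis l (k k' : 'I_(grank l)) :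
  gcoord k (gbasis k') = (k == k')%:R.
Proof.
suff /ffunP/(_ k) : [ffun k => @gcoord l k (gbasis k')] =
   [ffun k => (k == k')%:R] by rewrite !ffunE.
apply: gbasis_free; under eq_bigr do rewrite ffunE.
rewrite -gcoordE (gprojE l (gbasis_in k')) eqxx (bigD1 k') //= ffunE eqxx.
by rewrite big1 ?addr0 // => i ik; rewrite ffunE (negPf ik) mulr0z.
Qed.

End GradedAlgebra.

(** * Homogeneous components of tensor powers *)

Section GradedTensor.
Variables (A : comPzRingType) (A_ : nat -> {pred A}).
Hypothesis hA : graded_algebra A_.

Lemma tensor_homogeneous_zspan (I : finType) (x : tensor I A) :
  x \in zspan (fun z => exists j, z \in @tensor_deg A A_ I j).
Proof.
apply: (zspan_sub _ (tensor_zspan x)) => _ [a ->].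
apply: (zspanS _ (pure_zspan (S := fun _ y => exists k, y \in A_ k) _)) => [z|i].
  case=> b bk ->; have [k bkE] := choice bk.
  exists (\sum_i [ffun i => k i] i)%N; apply: mem_zspan.
  by exists b, [ffun i => k i]; split=> // i; rewrite ffunE.
have [n ->] := gproj_sum hA (a i).
by apply: rpred_sum => k _; apply: mem_zspan; exists k; exact: gproj_in.
Qed.

Lemma prod_homogeneous (I : finType) (P : pred I) (a : I -> A) (k : I -> nat) :
  (forall i, a i \in A_ (k i)) ->
  \prod_(i | P i) a i \in A_ (\sum_(i | P i) k i)%N.
Proof.
move=> ak; elim/big_ind2: _ => [|x m y n|i _]; last exact: ak.
  exact: graded_one hA.
exact: graded_mul.
Qed.

Lemma pushforward_deg (I J : finType) (h : I -> J) j (x : tensor I A) :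
  x \in tensor_deg A_ j -> pushforward h x \in tensor_deg A_ j.
Proof.
apply: (@zspan_morph _ _ _ _ (pushforward h)) => _ [a [k [ak <- ->]]] /=.
rewrite pushforward_pure; apply: mem_zspan.
exists [ffun j => \prod_(i | h i == j) a i], [ffun j => \sum_(i | h i == j) k i]%N.
split=> // [i|]; first by rewrite !ffunE; exact: prod_homogeneous.
rewrite [RHS](partition_big h predT) //=.
by apply: eq_bigr => i _; rewrite ffunE.
Qed.

Section Projection.
Variables (I : finType) (j : nat).

(** Degrees of factors adding up to [j] are at most [j], so basis elements up to that degree suffice
    and the index type is finite. *)
Definition basis_index := {k : 'I_j.+1 & 'I_(grank hA k)}.
HB.instance Definition _ := Finite.on basis_index.
Definition basis_elt (t : basis_index) : A := gbasis (tagged t).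
Implicit Types (beta : {ffun I -> basis_index}) (x : tensor I A).

Lemma coord_multiadditive beta : multiadditive (fun a : {ffun I -> A} =>
  \prod_i gcoord (tagged (beta i)) (a i)).
Proof.
move=> a i x y; set c := \prod_(k | k != i) gcoord (tagged (beta k)) (a k).
suff E z : \prod_k gcoord (tagged (beta k)) (upd a i z k) =
  gcoord (tagged (beta i)) z * c by rewrite !E raddfD mulrDl.
rewrite (bigD1 i) //= ffunE eqxx; congr (_ * _).
by apply: eq_bigr => k /negPf ki; rewrite ffunE ki.
Qed.

Definition tcoord beta : tensor I A -> int :=
  tensor_lift (coord_multiadditive beta).

HB.instance Definition _ beta :=
  GRing.isZmodMorphism.Build (tensor I A) int (tcoord beta)
    (tensor_lift_is_zmod_morphism (coord_multiadditive beta)).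

(** The projection onto the degree [j] part along the other degrees, written in the basis of pure
    tensors of homogeneous basis elements. *)
Definition tproj x : tensor I A :=
  \sum_(beta : {ffun I -> basis_index} | (\sum_i tag (beta i) == j)%N)
    pure [ffun i => basis_elt (beta i)] *~ tcoord beta x.

Lemma tproj_is_zmod_morphism : zmod_morphism tproj.
Proof.
move=> x y; rewrite /tproj -sumrB; apply: eq_bigr => b _.
by rewrite raddfB mulrzBr.
Qed.

HB.instance Definition _ :=
  GRing.isZmodMorphism.Build (tensor I A) (tensor I A) tproj
    tproj_is_zmod_morphism.

Lemma tproj_deg x : tproj x \in tensor_deg A_ j.
Proof.
apply: rpred_sum => b /eqP bj; apply/rpredMz/mem_zspan.
exists [ffun i => basis_elt (b i)], [ffun i => tag (b i) : nat]; split=> //.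
  by move=> i; rewrite !ffunE; exact: gbasis_in.
by rewrite -[RHS]bj; apply: eq_bigr => i _; rewrite ffunE.
Qed.

Lemma tproj_other m x : m != j -> x \in tensor_deg A_ m -> tproj x = 0.
Proof.
move=> mj; apply: zspan_eq0 => _ [a [k [ak km ->]]] /=.
rewrite /tproj big1 // => b /eqP bj; rewrite /tcoord tensor_lift_pure.
have [i ki] : exists i, k i != tag (b i) :> nat.
  apply/existsP; apply: contraR mj => /existsPn kb; rewrite -km -bj.
  by apply/eqP/eq_bigr => i _; apply/eqP; rewrite -[_ == _]negbK.
by rewrite (bigD1 i) //= (gcoord_homogeneous _ (ak i) ki) mul0r mulr0z.
Qed.

Lemma tcoord_basis beta beta' :
  tcoord beta (pure [ffun i => basis_elt (beta' i)]) = (beta == beta')%:R.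
Proof.
rewrite /tcoord tensor_lift_pure; case: eqVneq => [->|].
  by rewrite big1 // => i _; rewrite ffunE gcoord_basis eqxx.
move=> bb; have [i bi] : exists i, beta i != beta' i.
  apply/existsP; apply: contraR bb => /existsPn bb; apply/eqP/ffunP => i.
  by apply/eqP; rewrite -[_ == _]negbK.
rewrite (bigD1 i) //= ffunE; move: bi.
case: (beta i) (beta' i) => [k s] [k' s']; rewrite /basis_elt /= => bi.
case: (eqVneq k' k) s' bi => [->|kk] s' bi.
  rewrite gcoord_basis; case: eqVneq => [ss|]; last by rewrite mul0r.
  by move: bi; rewrite ss eqxx.
by rewrite (gcoord_homogeneous _ (gbasis_in _)) ?mul0r.
Qed.

Lemma tproj_id x : x \in tensor_deg A_ j -> tproj x = x.
Proof.
apply: (@zspan_eq _ _ _ tproj idfun) => _ [a [k [ak kj ->]]] /=.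
have kle i : (k i < j.+1)%N by rewrite ltnS -kj (bigD1 i) //= leq_addr.
apply: (@zspan_eq _ _ _ tproj idfun _ _
  (pure_zspan (S := fun i y => exists2 t : basis_index,
     tag t = k i :> nat & y = basis_elt t) _)) => [_ [b bt ->] /=|i]; last first.
  have -> : a i = gproj hA (k i) (a i) by rewrite (gprojE _ _ (ak i)) eqxx.
  rewrite gcoordE; apply: rpred_sum => s _; apply/rpredMz/mem_zspan.
  by exists (existT _ (Ordinal (kle i)) s).
have /choice[t tk] : forall i, exists t : basis_index,
    tag t = k i :> nat /\ b i = basis_elt t.
  by move=> i; have [t] := bt i; exists t.
have -> : b = [ffun i => basis_elt ([ffun i => t i] i)].
  by apply/ffunP => i; rewrite !ffunE (tk i).2.
rewrite /tproj (bigD1 [ffun i => t i]) /=; last first.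
  by apply/eqP; rewrite -[RHS]kj; apply: eq_bigr => i _; rewrite ffunE (tk i).1.
rewrite tcoord_basis eqxx big1 ?addr0 // => c /andP[_ /negPf ct].
by rewrite tcoord_basis ct.
Qed.

(** The coordinates [tcoord] take values in [int], which has no torsion, and by [tproj_id] they
    determine a homogeneous tensor. *)
Lemma tensor_deg_torsion_free x n :
  x \in tensor_deg A_ j -> (0 < n)%N -> x *+ n = 0 -> x = 0.
Proof.
move=> xj n0 xn; rewrite -(tproj_id xj) /tproj big1 // => b _.
suff -> : tcoord b x = 0 by [].
have /eqP : tcoord b (x *+ n) = 0 by rewrite xn raddf0.
by rewrite raddfMn mulrn_eq0 eqn0Ngt n0 => /eqP.
Qed.

End Projection.

Lemma pushforward_tproj (I J : finType) (h : I -> J) j (x : tensor I A) :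
  pushforward h (tproj j x) = tproj j (pushforward h x).
Proof.
apply: (@zspan_eq _ _ _ (pushforward h \o @tproj I j) (@tproj J j \o pushforward h)
  _ _ (tensor_homogeneous_zspan x)) => y [m ym] /=.
have [jm|mj] := eqVneq m j; first by rewrite -jm !tproj_id ?pushforward_deg.
by rewrite (tproj_other mj ym) (tproj_other mj (pushforward_deg h ym)) raddf0.
Qed.

End GradedTensor.

(** * Components, bridges and leaves *)

Section GraphTheory.
Variable G : mgraph.
Local Notation V := (vertex G).
Local Notation E := 'I_(nedges G).
Implicit Types (s t P Q : {set E}) (e f : E) (x y u v : V).

Definition joins e x y := (ends e == (x, y)) || (ends e == (y, x)).

Lemma joinsC e x y : joins e x y = joins e y x.
Proof. exact: orbC. Qed.

Lemma joins_ends e : joins e (ends e).1 (ends e).2.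
Proof. by rewrite /joins -surjective_pairing eqxx. Qed.

Lemma connectC s x y : connect (adj s) x y = connect (adj s) y x.
Proof. exact: adj_connect_sym. Qed.

Lemma joins_connect s e x y : e \in s -> joins e x y -> connect (adj s) x y.
Proof. by move=> es exy; apply/connect1/existsP; exists e; rewrite es. Qed.

Lemma connect_map s t (r : V -> V) x y :
  (forall e u v, e \in s -> joins e u v -> connect (adj t) (r u) (r v)) ->
  connect (adj s) x y -> connect (adj t) (r x) (r y).
Proof.
move=> rst /connectP[p]; elim: p x => [|z p IH] x /=; first by move=> _ ->.
case/andP=> /existsP[e /andP[es exz]] /IH{IH}IH /IH.
exact: connect_trans (rst _ _ _ es exz).
Qed.

Lemma connect_subset s t x y : s \subset t ->
  connect (adj s) x y -> connect (adj t) x y.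
Proof.
move=> /subsetP st; apply: (connect_map (r := id)) => e u v /st.
exact: joins_connect.
Qed.

Lemma connect_setU1 s e x y u v : joins e x y ->
  connect (adj (e |: s)) u v =
  [|| connect (adj s) u v, connect (adj s) u x && connect (adj s) y v
    | connect (adj s) u y && connect (adj s) x v].
Proof.
case/orP=> /eqP exy; rewrite (connect_adjU1 _ _ _ exy) //.
by congr (_ || _); rewrite orbC.
Qed.

Definition bridge s e := ~~ connect (adj (s :\ e)) (ends e).1 (ends e).2.

Lemma bridge_joins s e x y : joins e x y ->
  bridge s e = ~~ connect (adj (s :\ e)) x y.
Proof. by rewrite /bridge => /orP[]/eqP-> //=; rewrite connectC. Qed.

Lemma bridge_subset s t e : s \subset t -> bridge t e -> bridge s e.
Proof. by move=> st; apply/contra/connect_subset/setSD. Qed.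

Lemma ncomponentsE s : ncomponents s = #|{: component s}|.
Proof.
rewrite [RHS]card_sig /ncomponents; apply: eq_card => x.
by rewrite !inE andbT.
Qed.

(** Apart from the component of one endpoint of [e], the components of [s] stay pairwise distinct
    when [e] is added, since a merger through [e] involves that component. *)
Lemma ncomponents_setU1 s e :
  (ncomponents s <= (ncomponents (e |: s)).+1)%N.
Proof.
rewrite !ncomponentsE; set a := component_of s (ends e).1.
rewrite (cardD1 a) ltnS.
pose g (c : component s) := component_of (e |: s) (val c).
rewrite -(@card_in_image _ _ g); first exact: max_card.
have na c : c \in [predD1 {: component s} & a] ->
    connect (adj s) (val c) (ends e).1 = false.
  rewrite !inE andbT => /negPf.
  by rewrite -{1}[c]component_ofE eq_component_of.
move=> c d /na ca /na da /eqP; rewrite /g eq_component_of.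
rewrite (connect_setU1 _ _ _ (joins_ends e)) ca [connect _ _ (val d)]connectC.
rewrite [connect _ (ends e).1 _]connectC da andbF /= orbF connectC.
by rewrite -eq_component_of !component_ofE => /eqP.
Qed.

Lemma ncomponents_setD1 s e : e \in s -> ~~ bridge s e ->
  ncomponents (s :\ e) = ncomponents s.
Proof.
move=> es; rewrite negbK => be; apply: eq_n_comp => x y.
apply/idP/idP; first exact/connect_subset/subD1set.
rewrite -{1}(setD1K es) (connect_setU1 _ _ _ (joins_ends e)).
case/or3P => // /andP[xe ey]; apply: connect_trans xe _.
  exact: connect_trans be ey.
by rewrite connectC in be; exact: connect_trans be ey.
Qed.

Lemma ncomponents_setD P Q : P \subset Q ->
  (ncomponents P <= ncomponents Q + #|Q :\: P|)%N.
Proof.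
have [n] := ubnP #|Q :\: P|; elim: n P => // n IH P QP PQ.
have [Q0|[e]] := set_0Vmem (Q :\: P).
  have -> : P = Q by apply/eqP; rewrite eqEsubset PQ -setD_eq0 Q0 eqxx.
  exact: leq_addr.
rewrite inE => /andP[eP eQ]; have ePQ : e |: P \subset Q.
  by rewrite subUset sub1set eQ.
have QPE : #|Q :\: P| = #|Q :\: (e |: P)|.+1.
  by rewrite (cardsD1 e (Q :\: P)) inE eP eQ setDDl setUC.
have := IH (e |: P) _ ePQ; rewrite QPE in QP *; move=> /(_ QP).
rewrite addnS => IHP; apply: leq_trans (ncomponents_setU1 P e) _.
by rewrite ltnS.
Qed.

Lemma ncomponents_set0 : (#|{: V}| <= ncomponents (set0 : {set E}))%N.
Proof.
rewrite ncomponentsE; apply: (leq_card (component_of set0)) => x y /eqP.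
rewrite eq_component_of => /connectP[[|z p] /=]; first by move=> _ ->.
by case/andP=> /existsP[e]; rewrite inE.
Qed.

Lemma ncomponents_vertices s : (ncomponents s <= #|{: V}|)%N.
Proof. exact: max_card. Qed.

(* Among all pairs (e, x) of an edge of Q outside P and an endpoint x of e,
   choose one for which the component of x in Q - e is smallest: an edge f != e
   touching the P-component of x would cut off a smaller piece. *)
Lemma exists_leaf P Q : P \subset Q -> Q :\: P != set0 ->
  (forall e, e \in Q :\: P -> bridge Q e) ->
  exists e x y, [/\ e \in Q :\: P, joins e x y &
    forall f u v, f \in Q :\: P -> f != e -> joins f u v ->
      ~~ connect (adj P) x u].
Proof.
move=> PQ /set0Pn[e0 e0QP] brQ.
pose endpt (p : E * bool) := if p.2 then (ends p.1).1 else (ends p.1).2.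
pose side (p : E * bool) := [set z | connect (adj (Q :\ p.1)) (endpt p) z].
have [[e b] /= eQP min] := @arg_minnP _ (e0, true)
  (fun p : E * bool => p.1 \in Q :\: P) (fun p => #|side p|) e0QP.
pose x := endpt (e, b); pose y := endpt (e, ~~ b).
have exy : joins e x y.
  by rewrite /x /y; case: (b) => /=; [|rewrite joinsC]; exact: joins_ends.
exists e, x, y; split=> // f u v fQP fe fuv; apply/negP => xu.
have := brQ e eQP; rewrite (bridge_joins _ exy) => /negP; apply.
have bf := brQ f fQP; rewrite (bridge_joins _ fuv) in bf.
have PQf : P \subset Q :\ f.
  by rewrite subsetD1 PQ; move: fQP; rewrite inE => /andP[].
have PQe : P \subset Q :\ e.
  by rewrite subsetD1 PQ; move: eQP; rewrite inE => /andP[].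
have xuf := connect_subset PQf xu; have xue := connect_subset PQe xu.
have fQ : f \in Q by move: fQP; rewrite inE => /andP[].
have eQ : e \in Q by move: eQP; rewrite inE => /andP[].
have [c vE] : exists c, v = endpt (f, c).
  case/orP: fuv => /eqP fE; [exists false | exists true];
  by rewrite /endpt /= fE.
(* Against minimality, the side of [v] in [Q :\ f] is a proper part of the side of [x] in
   [Q :\ e]. *)
have := min (f, c) fQP; rewrite leqNgt => /negP; case.
apply: proper_card; apply/properP; split; last first.
  exists x; rewrite !inE /= ?connect0 // -vE.
  apply: contra bf => vx; rewrite connectC.
  exact: connect_trans vx xuf.
apply/subsetP => z; rewrite !inE /= -vE => vz.
have uv : connect (adj (Q :\ e)) u v.
  by apply: joins_connect fuv; rewrite !inE fe.
apply: connect_trans xue (connect_trans uv _).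
have QfE : Q :\ f = e |: (Q :\ f :\ e).
  by rewrite setD1K // !inE eq_sym fe.
have sub w w' : connect (adj (Q :\ f :\ e)) w w' -> connect (adj (Q :\ e)) w w'.
  by apply: connect_subset; rewrite setSD // subD1set.
have sub' w w' : connect (adj (Q :\ f :\ e)) w w' -> connect (adj (Q :\ f)) w w'.
  by apply: connect_subset; rewrite subD1set.
have nvx : ~ connect (adj (Q :\ f)) v x.
  move=> vx; move/negP: bf; apply; rewrite connectC.
  exact: connect_trans vx xuf.
have xyf : connect (adj (Q :\ f)) x y.
  by apply: joins_connect exy; rewrite !inE eq_sym fe.
(* If the path from [v] to [z] crossed [e], then [v] would reach [x] or [y], hence [x], without
   using [f], and [f] would not be a bridge. *)
move: vz; rewrite {1}QfE (connect_setU1 _ _ _ exy).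
case/or3P => [/sub//|/andP[/sub' vx _]|/andP[/sub' vy _]].
  by case: (nvx vx).
by case: nvx; rewrite connectC in xyf; exact: connect_trans vy xyf.
Qed.

End GraphTheory.

(** * Relative cochain complexes *)

Section RelativeDifferential.
Variables (A : comPzRingType) (G : mgraph).
Local Notation V := (vertex G).
Local Notation E := 'I_(nedges G).
Local Notation family := (forall s : {set E}, state A s).
Implicit Types (s t u P Q : {set E}) (e f : E) (x y : family).

Lemma component_of_val s t (v : V) : s \subset t ->
  component_of t (val (component_of s v)) = component_of t v.
Proof.
move=> st; apply/eqP; rewrite eq_component_of; apply: (connect_subset st).
by rewrite -eq_component_of component_ofE.
Qed.

Lemma edge_map_comp s t u (a : state A s) : t \subset u ->
  edge_map u (edge_map t a) = edge_map u a.
Proof.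
move=> tu; rewrite /edge_map pushforward_comp.
by apply: eq_pushforward => c /=; rewrite component_of_val.
Qed.

(** Taking away the smaller edge [e] lowers by one the number of edges before [f]; taking away [f]
    leaves those before [e] unchanged. *)
Lemma edge_sign_lt t e f : e \in t -> (e < f)%N ->
  edge_sign (t :\ e :\ f) f = - edge_sign (t :\ f) f /\
  edge_sign (t :\ f :\ e) e = edge_sign (t :\ e) e.
Proof.
move=> et ef; split; rewrite /edge_sign.
  rewrite [in RHS](cardsD1 e) !inE et ef neq_ltn ef /= exprS mulN1r opprK.
  congr (_ ^+ _); apply: eq_card => g; rewrite !inE.
  by case: (g == e); case: (g == f); rewrite ?andbF.
congr (_ ^+ _); apply: eq_card => g; rewrite !inE.
by case: (eqVneq g f) => [->|_]; rewrite ?andbF //= ltnNge (ltnW ef) !andbF.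
Qed.

Lemma edge_sign_anticomm t e f : e \in t -> f \in t -> e != f ->
  edge_sign (t :\ e :\ f) f * edge_sign (t :\ e) e =
  - (edge_sign (t :\ f :\ e) e * edge_sign (t :\ f) f).
Proof.
move=> et ft; rewrite neq_ltn => /orP[ef|fe].
  by have [-> ->] := edge_sign_lt et ef; rewrite mulNr mulrC.
by have [-> ->] := edge_sign_lt ft fe; rewrite mulNr opprK mulrC.
Qed.

Lemma edge_signK s e : edge_sign s e * edge_sign s e = 1.
Proof. by rewrite -expr2 sqrr_sign. Qed.

(* The differential of the complex spanned by the sets of edges containing P,
   which computes the cohomology of G with the edges of P contracted. *)
Definition rdiff P x : family := fun t =>
  \sum_(e | (e \in t) && (e \notin P))
    edge_map t (x (t :\ e)) *~ edge_sign (t :\ e) e.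

Lemma rdiffB P x y t :
  rdiff P (fun s => x s - y s) t = rdiff P x t - rdiff P y t.
Proof.
by rewrite /rdiff -[RHS]sumrB; apply: eq_bigr => e _; rewrite raddfB mulrzBl.
Qed.

Lemma rdiffD P x y t :
  rdiff P (fun s => x s + y s) t = rdiff P x t + rdiff P y t.
Proof.
by rewrite /rdiff -[RHS]big_split; apply: eq_bigr => e _; rewrite raddfD mulrzDl.
Qed.

Lemma rdiffMn P x n t : rdiff P (fun s => x s *+ n) t = rdiff P x t *+ n.
Proof.
rewrite /rdiff -[RHS]sumrMnl; apply: eq_bigr => e _.
by rewrite raddfMn !pmulrn mulrzAC.
Qed.

Lemma eq_rdiff P x y t :
  (forall e, e \in t -> e \notin P -> x (t :\ e) = y (t :\ e)) ->
  rdiff P x t = rdiff P y t.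
Proof. by move=> xy; apply: eq_bigr => e /andP[et eP]; rewrite xy. Qed.

Lemma rdiff0 P x t :
  (forall e, e \in t -> e \notin P -> x (t :\ e) = 0) -> rdiff P x t = 0.
Proof.
move=> x0; rewrite /rdiff big1 // => e /andP[et eP].
by rewrite x0 // raddf0 mul0rz.
Qed.

Lemma rdiffU1 P x t e : e \in t -> e \notin P ->
  rdiff P x t =
  edge_map t (x (t :\ e)) *~ edge_sign (t :\ e) e + rdiff (e |: P) x t.
Proof.
move=> et eP; rewrite /rdiff (bigD1 e) ?et //=; congr (_ + _).
by apply: eq_bigl => f; rewrite !inE negb_or -andbA [(f \notin P) && _]andbC.
Qed.

Lemma rdiff_rdiff P x t : rdiff P (rdiff P x) t = 0.
Proof.
pose F e f := edge_map t (x (t :\ e :\ f)) *~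
  (edge_sign (t :\ e :\ f) f * edge_sign (t :\ e) e).
pose T := t :\: P.
have -> : rdiff P (rdiff P x) t =
    \sum_(e in T) \sum_(f in T | f != e) F e f.
  rewrite /rdiff; apply: eq_big => [e|e /andP[et eP]]; first by rewrite inE andbC.
  rewrite raddf_sum mulrz_suml; apply: eq_big => [f|f _].
    by rewrite !inE; case: (f == e); case: (f \in P); case: (f \in t).
  by rewrite raddfMz /= edge_map_comp ?subD1set // /F mulrzA.
have FC e f : e \in T -> f \in T -> e != f -> F e f = - F f e.
  rewrite !inE => /andP[_ et] /andP[_ ft] ef; rewrite /F.
  by rewrite edge_sign_anticomm // mulrNz setDDl setUC -setDDl.
(* The pairs of distinct edges are split by order; once the summations of the first half are
   exchanged, terms cancel in pairs by [FC]. *)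
transitivity (\sum_(e in T) (\sum_(f in T | (f < e)%N) F e f +
    \sum_(f in T | (e < f)%N) F e f)).
  apply: eq_bigr => e eT; rewrite (bigID (fun f => (f < e)%N)) /=.
  congr (_ + _); apply: eq_bigl => f; rewrite neq_ltn.
    by case: ltngtP; rewrite ?andbF ?andbT.
  by case: ltngtP; rewrite ?andbF ?andbT.
rewrite big_split /= (exchange_big_dep (mem T)) /=; last by move=> e f _ /andP[].
rewrite -big_split big1 //= => e eT.
rewrite [X in X + _](eq_bigl (fun f => (f \in T) && (e < f)%N)); last first.
  by move=> f; rewrite eT.
rewrite -big_split /=.
rewrite big1 // => f /andP[fT ef].
by rewrite (FC f e) ?addNr // neq_ltn ef orbT.
Qed.

End RelativeDifferential.

Section RelativeCohomology.
Variables (A : comPzRingType) (A_ : nat -> {pred A}).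
Hypothesis hA : graded_algebra A_.
Variable G : mgraph.
Local Notation V := (vertex G).
Local Notation E := 'I_(nedges G).
Local Notation family := (forall s : {set E}, state A s).
Implicit Types (s t P Q : {set E}) (e f : E) (x y : family) (i j : nat).

Definition homogeneous j x := forall s, x s \in tensor_deg A_ j.

(** The index [i] is the size of the whole edge set, edges of [P] included, so the bottom degree is
    [#|P|]. *)
Definition cocycle_on P Q i x := forall t,
  P \subset t -> t \subset Q -> #|t| = i.+1 -> rdiff P x t = 0.

Definition coboundary_on P Q i x y := forall t,
  P \subset t -> t \subset Q -> #|t| = i -> x t = rdiff P y t.

Definition acyclic P Q i j := forall x, homogeneous j x -> cocycle_on P Q i x ->
  exists2 y, homogeneous j y & coboundary_on P Q i x y.

Definition torsion_free P Q i j := forall x y n,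
  homogeneous j x -> homogeneous j y -> (0 < n)%N -> cocycle_on P Q i x ->
  coboundary_on P Q i (fun s => x s *+ n) y ->
  exists2 y', homogeneous j y' & coboundary_on P Q i x y'.

Lemma homogeneous0 j : homogeneous j (fun s => 0).
Proof. by move=> s; exact: rpred0. Qed.

Lemma homogeneousB j x y : homogeneous j x -> homogeneous j y ->
  homogeneous j (fun s => x s - y s).
Proof. by move=> xj yj s; rewrite rpredB. Qed.

Lemma homogeneous_rdiff P j x : homogeneous j x -> homogeneous j (rdiff P x).
Proof.
move=> xj s; apply: rpred_sum => e _.
exact: rpredMz (pushforward_deg hA _ (xj _)).
Qed.

(** Extension by zero: it lifts a cochain relative to [P] and [Q :\ e] to one relative to [P] and
    [Q]. *)
Definition without e x : family := fun s => if e \in s then 0 else x s.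

Lemma homogeneous_without e j x : homogeneous j x -> homogeneous j (without e x).
Proof. by move=> xj s; rewrite /without; case: ifP => _; rewrite ?rpred0. Qed.

Lemma rdiff_without P x e t : e \notin t -> rdiff P (without e x) t = rdiff P x t.
Proof.
move=> et; apply: eq_rdiff => f _ _; rewrite /without !inE.
by rewrite (negPf et) andbF.
Qed.

Lemma coboundary_onD P Q i x y z :
  coboundary_on P Q i (fun s => x s - rdiff P y s) z ->
  coboundary_on P Q i x (fun s => y s + z s).
Proof.
by move=> H t Pt tQ ti; rewrite rdiffD -(H t Pt tQ ti) addrC subrK.
Qed.

Section Step.
Variables (P Q : {set E}) (e : E).
Hypothesis eP : e \notin P.

(* x is relative to [P, Q]; the support condition says that it comes from the
   subcomplex [e |: P, Q]. *)
Definition supported i x := forall t,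
  P \subset t -> t \subset Q -> #|t| = i -> e \notin t -> x t = 0.

Lemma supported_sub i x y : coboundary_on P (Q :\ e) i x y ->
  supported i (fun s => x s - rdiff P (without e y) s).
Proof.
move=> xy t Pt tQ ti et; rewrite rdiff_without // (xy t) ?subrr //.
by rewrite subsetD1 tQ.
Qed.

(** The term of the differential that adds [e] reads [x] at [t :\ e], where it vanishes. *)
Lemma supported_rdiff i x t : supported i x -> e |: P \subset t ->
  t \subset Q -> #|t| = i.+1 -> rdiff P x t = rdiff (e |: P) x t.
Proof.
rewrite subUset sub1set => xS /andP[et Pt] tQ ti.
rewrite (rdiffU1 x et eP) xS ?raddf0 ?mul0rz ?add0r //.
- by rewrite subsetD1 Pt.
- exact: subset_trans (subD1set _ _) tQ.
- by move: ti; rewrite (cardsD1 e) et => -[].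
- by rewrite !inE eqxx.
Qed.

Lemma cocycle_on_sub i x y : cocycle_on P Q i x ->
  cocycle_on P Q i (fun s => x s - rdiff P y s).
Proof.
by move=> xc t Pt tQ ti; rewrite rdiffB xc // rdiff_rdiff subrr.
Qed.

Lemma supported_cocycle i x : supported i x -> cocycle_on P Q i x ->
  cocycle_on (e |: P) Q i x.
Proof.
move=> xS xc t Pt tQ ti; rewrite -(supported_rdiff xS) // xc //.
by move: Pt; rewrite subUset => /andP[].
Qed.

Lemma supported_coboundary i j x y : supported i x -> homogeneous j y ->
  coboundary_on (e |: P) Q i x y ->
  exists2 z, homogeneous j z & coboundary_on P Q i x z.
Proof.
move=> xS yj xy; exists (fun s => if e \in s then y s else 0).
  by move=> s; case: ifP => _; rewrite ?rpred0.
move=> t Pt tQ ti; have [et|et] := boolP (e \in t); last first.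
  rewrite xS // rdiff0 // => f _ _.
  by rewrite !inE (negPf et) andbF.
rewrite (rdiffU1 _ et eP) !inE eqxx /= raddf0 mul0rz add0r.
rewrite (xy t) //; last by rewrite subUset sub1set et.
apply: eq_rdiff => f ft; rewrite !inE negb_or et andbT => /andP[fe _].
by rewrite eq_sym fe.
Qed.

Lemma cocycle_on_setD1 i x : cocycle_on P Q i x -> cocycle_on P (Q :\ e) i x.
Proof.
move=> xc t Pt tQ; apply: xc => //; exact: subset_trans tQ (subD1set _ _).
Qed.

(** A primitive on the deletion is extended by zero and its coboundary subtracted; the remainder is
    supported on the sets containing [e], hence is a cocycle of the contraction. *)
Lemma acyclic_step i j : acyclic P (Q :\ e) i j -> acyclic (e |: P) Q i j ->
  acyclic P Q i j.
Proof.
move=> HD HC x xj xc; have [y yj xy] := HD x xj (cocycle_on_setD1 xc).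
have xS := supported_sub xy.
have yj' := homogeneous_without e yj.
have [z zj xz] := HC _ (homogeneousB xj (homogeneous_rdiff P yj'))
  (supported_cocycle xS (cocycle_on_sub (without e y) xc)).
have [w wj xw] := supported_coboundary xS zj xz.
exists (fun s => without e y s + w s); last exact: coboundary_onD.
by move=> s; exact: rpredD (yj' s) (wj s).
Qed.

(** The class restricts to a torsion class, hence to zero, on the deletion, and so comes from the
    contraction. The obstruction to its being torsion there is a class of degree [i] on the
    deletion, which acyclicity kills. *)
Lemma torsion_free_step i j : acyclic P (Q :\ e) i j ->
  torsion_free P (Q :\ e) i.+1 j -> torsion_free (e |: P) Q i.+1 j ->
  torsion_free P Q i.+1 j.
Proof.
move=> aD HD HC x y n xj yj n0 xc xny.
have [u uj xu] : exists2 u, homogeneous j u & coboundary_on P (Q :\ e) i.+1 x u.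
  apply: (HD x y n xj yj n0 (cocycle_on_setD1 xc)) => t Pt tQ.
  by apply: xny => //; exact: subset_trans tQ (subD1set _ _).
have xS := supported_sub xu; have uj' := homogeneous_without e uj.
pose x' s := x s - rdiff P (without e u) s.
pose w s := y s - without e u s *+ n.
have wj : homogeneous j w by move=> s; exact: rpredB (yj s) (rpredMn n (uj' s)).
have xw : coboundary_on P Q i.+1 (fun s => x' s *+ n) w.
  by move=> t Pt tQ ti; rewrite rdiffB rdiffMn -xny // mulrnBl.
(* The coboundary of [w] is [x' *+ n], zero on sets avoiding [e]. So [w] restricts to a cocycle, and
   subtracting the coboundary of [v] makes it supported on the sets containing [e]. *)
have wc : cocycle_on P (Q :\ e) i w.
  move=> t Pt; rewrite subsetD1 => /andP[tQ et] ti.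
  by rewrite -xw // /x' xS // mul0rn.
have [v vj wv] := aD w wj wc; have vj' := homogeneous_without e vj.
have wS := supported_sub wv.
have x'j := homogeneousB xj (homogeneous_rdiff P uj').
have [z zj xz] : exists2 z, homogeneous j z & coboundary_on (e |: P) Q i.+1 x' z.
  apply: (HC _ _ n x'j (homogeneousB wj (homogeneous_rdiff P vj')) n0).
    exact: supported_cocycle xS (cocycle_on_sub (without e u) xc).
  move=> t ePt tQ ti; rewrite -(supported_rdiff wS) // rdiffB rdiff_rdiff subr0.
  by apply: xw => //; move: ePt; rewrite subUset => /andP[].
have [z' zj' xz'] := supported_coboundary xS zj xz.
exists (fun s => without e u s + z' s); last exact: coboundary_onD.
by move=> s; exact: rpredD (uj' s) (zj' s).
Qed.

End Step.

Lemma subset_card_eq P t : P \subset t -> (#|t| <= #|P|)%N -> t = P.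
Proof. by move=> Pt tP; apply/eqP; rewrite eq_sym eqEcard Pt. Qed.

Lemma rdiff_bottom P x : rdiff P x P = 0.
Proof. by apply: rdiff0 => e ->. Qed.

Lemma rdiff_setU1 P x f : f \notin P ->
  rdiff P x (f |: P) = edge_map (f |: P) (x P) *~ edge_sign P f.
Proof.
move=> fP; rewrite (rdiffU1 _ (setU11 _ _) fP) setU1K // rdiff_bottom addr0 //.
Qed.

Lemma mulr_sign_eq0 (M : zmodType) (z : M) P e :
  z *~ edge_sign P e = 0 -> z = 0.
Proof.
by move=> ze; rewrite -[z]mulr1z -(edge_signK P e) mulrzA ze mul0rz.
Qed.

Lemma acyclic_below P Q i j : (i < #|P|)%N -> acyclic P Q i j.
Proof.
move=> iP x _ _; exists (fun s => 0); first exact: homogeneous0.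
by move=> t /subset_leq_card Pt _ ti; move: iP; rewrite -ti ltnNge Pt.
Qed.

(** Only the set [P] itself can occur; no nonzero coboundary lives there, and homogeneous tensors
    have no torsion. *)
Lemma torsion_free_below P Q i j : (i <= #|P|)%N -> torsion_free P Q i j.
Proof.
move=> iP x y n xj yj n0 _ xny; exists (fun s => 0); first exact: homogeneous0.
move=> t Pt tQ ti; have tP : t = P by apply: subset_card_eq; rewrite ?ti.
rewrite tP rdiff_bottom; apply: (tensor_deg_torsion_free hA (xj P) n0).
by rewrite -(rdiff_bottom P y); apply: xny; rewrite -tP.
Qed.

End RelativeCohomology.

(** * Forests *)

Section Leaf.
Variable G : mgraph.
Local Notation V := (vertex G).
Local Notation E := 'I_(nedges G).
Implicit Types (s t P Q : {set E}) (e f : E) (u v w x y : V).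

Variables (P : {set E}) (x y : V).

Definition prune v : V := if connect (adj P) x v then y else v.

(** Edges of [t] outside [P] do not touch the component of the leaf [x], so folding that component
    onto [y] turns every edge of [e |: t] into a connection in [t]. *)
Lemma connect_prune e t u v : joins e x y -> P \subset t ->
  (forall f u v, f \in t :\: P -> joins f u v -> ~~ connect (adj P) x u) ->
  connect (adj (e |: t)) u v -> connect (adj t) (prune u) (prune v).
Proof.
move=> exy Pt iso; apply: connect_map => f {}u {}v.
have py : prune y = y by rewrite /prune; case: ifP.
have px : prune x = y by rewrite /prune connect0.
have [->|fe] := eqVneq f e.
  move=> _ /orP[]/eqP efu; move: exy; rewrite /joins efu !xpair_eqE;
  by case/orP=> /andP[/eqP-> /eqP->]; rewrite ?px ?py connect0.
rewrite !inE (negPf fe) /= => ft fuv.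
have [fP|fP] := boolP (f \in P); last first.
  have ftP : f \in t :\: P by rewrite inE fP.
  rewrite /prune (negPf (iso f u v ftP fuv)).
  have fvu : joins f v u by rewrite joinsC.
  by rewrite (negPf (iso f v u ftP fvu)); exact: joins_connect ft fuv.
have uv := joins_connect fP fuv; rewrite /prune.
have -> : connect (adj P) x v = connect (adj P) x u.
  apply/idP/idP => xu; last exact: connect_trans xu uv.
  by rewrite connectC in uv; exact: connect_trans xu uv.
by case: ifP => _; [exact: connect0 | exact: connect_subset Pt uv].
Qed.

Lemma prune_connect e v : joins e x y -> connect (adj (e |: P)) (prune v) v.
Proof.
move=> exy; rewrite /prune; case: ifP => [xv|_]; last exact: connect0.
rewrite joinsC in exy.
apply: connect_trans (joins_connect (setU11 _ _) exy) _.
exact: connect_subset (subsetUr _ _) xv.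
Qed.

End Leaf.

Section VertexMap.
Variables (A : comPzRingType) (G : mgraph).
Local Notation V := (vertex G).
Local Notation E := 'I_(nedges G).
Implicit Types (s t u : {set E}) (r : V -> V).

(** The map [r] is evaluated at canonical vertices, so composition requires the outer map to
    preserve connectivity, as assumed in [vertex_map_comp]. *)
Definition component_map r s t (c : component s) : component t :=
  component_of t (r (val c)).

Definition vertex_map r s t : state A s -> state A t :=
  pushforward (@component_map r s t).

HB.instance Definition _ r s t := GRing.Additive.on (@vertex_map r s t).

Lemma eq_vertex_map r r' s t (a : state A s) :
  (forall v, connect (adj t) (r v) (r' v)) -> vertex_map r t a = vertex_map r' t a.
Proof.
move=> rr; apply: eq_pushforward => c; apply/eqP.
by rewrite eq_component_of.
Qed.

Lemma vertex_map_comp r r' s t u (a : state A s) :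
  (forall v w, connect (adj t) v w -> connect (adj u) (r' v) (r' w)) ->
  vertex_map r' u (vertex_map r t a) = vertex_map (r' \o r) u a.
Proof.
move=> rtu; rewrite /vertex_map pushforward_comp.
apply: eq_pushforward => c; apply/eqP; rewrite eq_component_of; apply: rtu.
by rewrite -eq_component_of component_ofE.
Qed.

Lemma edge_map_vertex_map r s t u (a : state A s) : t \subset u ->
  edge_map u (vertex_map r t a) = vertex_map r u a.
Proof.
move=> tu; have tu' v w := @connect_subset G t u v w tu.
exact: (vertex_map_comp r (r' := id) a tu').
Qed.

Lemma vertex_map_edge_map r s t u (a : state A s) :
  (forall v w, connect (adj t) v w -> connect (adj u) (r v) (r w)) ->
  vertex_map r u (edge_map t a) = vertex_map r u a.
Proof. by move=> rtu; exact: (vertex_map_comp id (r' := r) a rtu). Qed.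

Lemma vertex_map_id s (a : state A s) : vertex_map id s a = a.
Proof.
by rewrite -[RHS]pushforward_id; apply: eq_pushforward => c; exact: component_ofE.
Qed.

End VertexMap.

Section Forest.
Variables (A : comPzRingType) (A_ : nat -> {pred A}).
Hypothesis hA : graded_algebra A_.
Variable G : mgraph.
Local Notation V := (vertex G).
Local Notation E := 'I_(nedges G).
Local Notation family := (forall s : {set E}, state A s).
Implicit Types (s t P Q : {set E}) (e f : E) (i j : nat).

Lemma subset_cardS P t i : P \subset t -> #|t| = i.+1 -> #|P| = i ->
  exists2 f, f \notin P & t = f |: P.
Proof.
move=> Pt ti Pi; have : t :\: P != set0.
  by rewrite setD_eq0; apply/negP => /subset_leq_card; rewrite ti Pi ltnn.
case/set0Pn=> f; rewrite inE => /andP[fP ft]; exists f => //.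
apply: subset_card_eq; first by rewrite subUset sub1set ft.
by rewrite cardsU1 fP ti Pi.
Qed.

Lemma forest_subset P P' Q Q' : Q' :\: P' \subset Q :\: P -> Q' \subset Q ->
  (forall e, e \in Q :\: P -> bridge Q e) ->
  forall e, e \in Q' :\: P' -> bridge Q' e.
Proof. by move=> /subsetP D QQ br e /D/br; exact: bridge_subset. Qed.

Lemma forest_acyclic P Q i j : P \subset Q ->
  (forall e, e \in Q :\: P -> bridge Q e) -> (#|P| < i)%N -> acyclic A_ P Q i j.
Proof.
have [n] := ubnP #|Q :\: P|; elim: n P Q => // n IH P Q QP PQ br Pi.
have [Q0|QP0] := eqVneq (Q :\: P) set0.
  move=> x _ _; exists (fun s => 0); first exact: homogeneous0.
  move=> t Pt tQ ti; move: Pi; rewrite -ti ltnNge subset_leq_card //.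
  by apply: subset_trans tQ _; rewrite -setD_eq0 Q0.
have [e [x0 [y0 [eQP exy iso]]]] := exists_leaf PQ QP0 br.
have [eP eQ] : e \notin P /\ e \in Q by apply/andP; rewrite inE in eQP.
have QPD : Q :\ e :\: P = (Q :\: P) :\ e by rewrite setDDl setUC -setDDl.
have QPC : Q :\: (e |: P) = (Q :\: P) :\ e by rewrite setDDl setUC.
have QPlt : (#|(Q :\: P) :\ e| < n)%N by move: QP; rewrite (cardsD1 e) eQP.
have PQD : P \subset Q :\ e by rewrite subsetD1 PQ.
have PQC : e |: P \subset Q by rewrite subUset sub1set eQ.
have aD : acyclic A_ P (Q :\ e) i j.
  apply: IH => //; first by rewrite QPD.
  by apply: forest_subset br; rewrite ?QPD subD1set.
(* Above degree [#|P|.+1] the contraction also falls under the induction. In degree [#|P|.+1] it is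
   at its bottom, and a primitive is built by hand. *)
have [Pi1|Pi1] := ltnP #|P|.+1 i.
  apply: (acyclic_step hA eP aD); apply: IH => //; first by rewrite QPC.
    by apply: forest_subset br; rewrite ?QPC ?subD1set.
  by rewrite cardsU1 eP.
have {Pi Pi1} iE : i = #|P|.+1 by apply/eqP; rewrite eqn_leq Pi Pi1.
subst i => x xj xc.
have [z zj xz] := aD x xj (cocycle_on_setD1 xc).
have xS := supported_sub xz; have zj' := homogeneous_without e zj.
have xc' := supported_cocycle eP xS (cocycle_on_sub (without e z) xc).
have xj' := homogeneousB xj (homogeneous_rdiff hA P zj').
set x' : family := fun s => x s - rdiff P (without e z) s in xS xc' xj'.
(* At [P], the only set that matters, folding the leaf onto [y0] pulls back the value on [e |: P]
   and leaves the empty product 1 at the leaf. The sign cancels the one in the differential. *)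
pose y : family := fun s =>
  vertex_map (prune P x0 y0) s (x' (e |: P)) *~ edge_sign P e.
suff xy : coboundary_on P Q #|P|.+1 x' y.
  exists (fun s => without e z s + y s); last exact: coboundary_onD.
  move=> s; apply: rpredD (zj' s) _.
  exact: rpredMz (pushforward_deg hA _ (xj' _)).
move=> t Pt tQ ti; have [f fP tE] := subset_cardS Pt ti (erefl _).
have fQ : f \in Q by apply: (subsetP tQ); rewrite tE setU11.
rewrite {}tE {t} in Pt tQ ti *; rewrite rdiff_setU1 // /y raddfMz /=.
rewrite edge_map_vertex_map ?subsetUr //.
have [->|fe] := eqVneq f e.
  rewrite -mulrzA edge_signK mulr1z -[LHS]vertex_map_id.
  by apply: eq_vertex_map => v; rewrite connectC; exact: prune_connect.
have isof g u v : g \in (f |: P) :\: P -> joins g u v ->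
    ~~ connect (adj P) x0 u.
  rewrite !inE => /andP[gP] /orP[/eqP->|]; last by rewrite (negPf gP).
  by apply: iso; rewrite // inE fP.
rewrite xS ?subsetUr //; last by rewrite !inE negb_or eq_sym fe.
have feP : f \notin e |: P by rewrite !inE negb_or fe.
(* For [f != e] the left side is zero by support. The right side factors through [f |: (e |: P)],
   where the cocycle condition of the contraction kills it. *)
have x0E : edge_map (f |: (e |: P)) (x' (e |: P)) = 0.
  apply: (@mulr_sign_eq0 _ _ _ (e |: P) f); rewrite -rdiff_setU1 //.
  apply: xc'; first exact: subsetUr.
    by rewrite !subUset !sub1set fQ eQ.
  by rewrite !cardsU1 feP eP.
rewrite -(@vertex_map_edge_map _ _ _ _ (f |: (e |: P))).
  by rewrite x0E {x0E} raddf0 mul0rz mul0rz.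
by move=> v w; rewrite setUCA; apply: connect_prune => //; exact: subsetUr.
Qed.

End Forest.

(** * Scalar factors and the common kernel of the edge maps *)

Section Absorb.
Variables (A : comPzRingType) (I : finType) (w u : I).
Hypothesis wu : w != u.

Definition scalar (z : A) : Prop := exists m : int, z = m%:~R.

Definition scalar_at (c : I) (z : tensor I A) : Prop :=
  exists2 a : {ffun I -> A}, scalar (a c) & z = pure a.

Definition redirect (c : I) : I := if c == w then u else c.

(** The scalar comes out in front and leaves 1 at [w]. Multiplying that 1 into the factor at [u]
    changes nothing, and the empty product puts 1 back at [w]. *)
Lemma pushforward_redirect_scalar z :
  scalar_at w z -> pushforward redirect z = z.
Proof.
case=> a [m aw ->]; have -> : pure a = pure (upd a w 1) *~ m.
  rewrite -{1}(upd_id a w) aw.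
  exact: (raddfMz (pure_at a w) m 1).
rewrite raddfMz /= pushforward_pure; congr (pure _ *~ m); apply/ffunP => c.
rewrite !ffunE; case: eqVneq => [->|cw].
  rewrite big_pred0 // => i; rewrite /redirect; case: (eqVneq i w) => [_|iw].
    by rewrite eq_sym (negPf wu).
  exact: negPf.
rewrite (bigD1 c) /=; last by rewrite /redirect (negPf cw).
rewrite ffunE (negPf cw) big1 ?mulr1 // => i /andP[].
rewrite ffunE /redirect; case: (eqVneq i w) => // iw /eqP ->.
by rewrite eqxx.
Qed.

Lemma pushforward_redirect_at c z : c != w -> c != u ->
  scalar_at c z -> scalar_at c (pushforward redirect z).
Proof.
move=> cw cu [a ac ->]; rewrite pushforward_pure.
exists [ffun j => \prod_(i | redirect i == j) a i] => //.
rewrite ffunE (big_pred1 c) // => i; rewrite /redirect.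
case: (eqVneq i w) => [->|//]; rewrite eq_sym (negPf cu).
by rewrite /= eq_sym (negPf cw).
Qed.

End Absorb.

Section ForestKernel.
Variables (A : comPzRingType) (G : mgraph).
Local Notation V := (vertex G).
Local Notation E := 'I_(nedges G).
Implicit Types (s t P Q : {set E}) (e f : E) (i j : nat).

(* The operator pi is the composite, over the edges (c, parent of c) of the
   forest in order from the roots to the leaves, of the maps id - rho_c, where
   rho_c multiplies the factor at c into the factor at its parent.  Each of
   them fixes the common kernel, and id - rho_c kills the tensors with a
   scalar factor at c. *)
Lemma forest_projection P Q : P \subset Q ->
  (forall e, e \in Q :\: P -> bridge Q e) ->
  exists (W : {set component P}) (pi : {additive state A P -> state A P}),
  [/\ #|W| = #|Q :\: P|,
      forall z : state A P,
        (forall f, f \in Q :\: P -> edge_map (f |: P) z = 0) -> pi z = z,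
      forall c z, c \in W -> scalar_at c z -> pi z = 0
    & forall c : component P,
        (forall f u v, f \in Q :\: P -> joins f u v -> component_of P u != c) ->
        c \notin W /\
        forall z : state A P, scalar_at c z -> pi z \in zspan (@scalar_at A _ c)].
Proof.
have [n] := ubnP #|Q :\: P|; elim: n Q => // n IH Q QP PQ br.
have [Q0|QP0] := eqVneq (Q :\: P) set0.
  exists set0, idfun; split=> [|//|c z|c _]; first by rewrite Q0 !cards0.
    by rewrite inE.
  by rewrite inE; split=> // z; exact: mem_zspan.
have [e [x0 [y0 [eQP exy iso]]]] := exists_leaf PQ QP0 br.
have [eP eQ] : e \notin P /\ e \in Q by apply/andP; rewrite inE in eQP.
have QPD : Q :\ e :\: P = (Q :\: P) :\ e by rewrite setDDl setUC -setDDl.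
have PQD : P \subset Q :\ e by rewrite subsetD1 PQ.
have [||W [pi [Wcard pi_id pi0 pi_iso]]] := IH (Q :\ e) _ PQD.
- by rewrite QPD; move: QP; rewrite (cardsD1 e) eQP.
- by apply: forest_subset br; rewrite ?QPD subD1set.
rewrite QPD in Wcard pi_id pi0 pi_iso.
pose w := component_of P x0; pose u := component_of P y0.
have wu : w != u.
  rewrite eq_component_of; have := br e eQP; rewrite (bridge_joins _ exy).
  by apply: contra; exact: connect_subset.
(* No remaining edge touches the leaf component [w], so the last clause of the induction hypothesis
   applies to it; that clause is carried along for this purpose. *)
have /pi_iso[wW piw] : forall f v v', f \in (Q :\: P) :\ e -> joins f v v' ->
    component_of P v != w.
  move=> f v v' /setD1P[fe fQP] fv.
  by rewrite eq_component_of connectC; exact: iso fQP fe fv.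
pose rho := pushforward (redirect w u) : state A P -> state A P.
(* The map [rho] is the edge map of [e] followed by the folding of the leaf. *)
have rho0 z : edge_map (e |: P) z = 0 -> rho z = 0.
  move=> ez; have <- : vertex_map (prune P x0 y0) P (edge_map (e |: P) z) = 0.
    by rewrite ez {ez} raddf0.
  rewrite vertex_map_edge_map; last first.
    move=> v v'; apply: connect_prune => // f ? ?.
    by rewrite setDv inE.
  apply: eq_pushforward => c; rewrite /redirect /component_map /prune.
  rewrite -[c in c == w]component_ofE eq_component_of connectC.
  by case: ifP => // _; rewrite component_ofE.
pose pi' := (idfun \- pushforward (redirect w u)) \o pi.
exists (w |: W), pi'; split.
- by rewrite cardsU1 wW Wcard [in RHS](cardsD1 e) eQP.
- move=> z zker; have piz : pi z = z.
    by apply: pi_id => f /setD1P[_]; exact: zker.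
  by rewrite /pi' /= piz -[pushforward _ _]/(rho z) rho0 ?subr0 ?zker.
(* At an old index [pi] already gives zero. At [w], [pi z] is still a combination of tensors scalar
   at [w], which the new factor kills. *)
- move=> c z; rewrite !inE => /orP[/eqP-> /piw|cW cz]; last first.
    by rewrite /pi' /= (pi0 c z cW cz) raddf0 subr0.
  apply: (zspan_eq0 (f := idfun \- pushforward (redirect w u))) => z' zw /=.
  by rewrite (pushforward_redirect_scalar wu zw) subrr.
move=> c ciso; have ec v v' : joins e v v' -> component_of P v != c.
  exact: ciso eQP.
have wc : w != c := ec _ _ exy.
have uc : u != c by apply: (ec y0 x0); rewrite joinsC.
have /pi_iso[cW pic] : forall f v v', f \in (Q :\: P) :\ e -> joins f v v' ->
    component_of P v != c by move=> f v v' /setD1P[_]; exact: ciso.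
split=> [|z /pic]; first by rewrite !inE negb_or eq_sym wc.
apply: (zspan_morph (f := idfun \- pushforward (redirect w u))) => z' zc /=.
apply: rpredB; apply: mem_zspan => //.
by apply: pushforward_redirect_at; rewrite // eq_sym.
Qed.

Variable A_ : nat -> {pred A}.
Hypothesis A0_scalar : forall z, z \in A_ 0%N -> scalar z.

Lemma forest_kernel_eq0 P Q j (z : state A P) : P \subset Q ->
  (forall e, e \in Q :\: P -> bridge Q e) -> (j < #|Q :\: P|)%N ->
  z \in tensor_deg A_ j ->
  (forall f, f \in Q :\: P -> edge_map (f |: P) z = 0) -> z = 0.
Proof.
move=> PQ br jQP zj zker.
have [W [pi [Wcard pi_id pi0 _]]] := forest_projection PQ br.
rewrite -(pi_id z zker); apply: zspan_eq0 zj => _ [a [k [ak kj ->]]].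
(* The degrees [k c] add up to less than [#|W|], so one of them vanishes on [W]. *)
have /exists_inP[c cW /eqP kc] : [exists c in W, k c == 0%N].
  apply: contraLR jQP => /exists_inPn k0.
  rewrite -leqNgt -Wcard -kj -sum1_card.
  rewrite [X in (_ <= X)%N](bigID (mem W)) /=.
  apply: leq_trans (leq_addr _ _); apply: leq_sum => c cW.
  by rewrite lt0n; exact: k0.
apply: (pi0 c) => //; exists a => //; apply: A0_scalar.
by rewrite -kc; exact: ak.
Qed.

End ForestKernel.

(** * Deletion and contraction *)

(** In [z = m + a] with [a] in [A'], both [z] and the integer [m] have degree 0, hence so has [a]; a
    nonzero [a] would have positive degree. *)
Lemma pointed_degree0 (A : comPzRingType) (A_ : nat -> {pred A}) :
  graded_algebra A_ -> pointed A_ -> forall z, z \in A_ 0%N -> scalar z.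
Proof.
move=> hA [A' [_ A'span _ A'deg]] z z0; have [m [a aA' zE]] := A'span z.
have [gr0 grB] := graded_closed hA 0.
have m0 : m%:~R \in A_ 0%N.
  have <- : gproj hA 0%N m%:~R = m%:~R; last exact: gproj_in.
  by rewrite raddfMz /= (gprojE _ _ (graded_one hA)).
exists m; apply/eqP; rewrite zE -subr_eq0 addrAC subrr add0r; apply/negPn/negP.
have aE : a = z - m%:~R by rewrite zE addrAC subrr add0r.
by move/(A'deg 0%N a aA'); rewrite aE => /(_ (grB _ _ z0 m0)).
Qed.

Section Vanishing.
Variables (A : comPzRingType) (A_ : nat -> {pred A}).
Hypotheses (hA : graded_algebra A_) (hpointed : pointed A_).
Variable G : mgraph.
Local Notation E := 'I_(nedges G).
Implicit Types (s t P Q : {set E}) (e f : E) (i j : nat).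

Lemma forest_vanishing P Q i j : P \subset Q ->
  (forall e, e \in Q :\: P -> bridge Q e) ->
  (i + j + ncomponents Q < #|P| + ncomponents P)%N -> acyclic A_ P Q i j.
Proof.
move=> PQ br ij; case: (ltngtP i #|P|) => [iP|Pi|iP].
- exact: acyclic_below.
- exact: (forest_acyclic hA PQ br Pi).
move=> x xj xc; exists (fun s => 0); first exact: homogeneous0.
move=> t Pt tQ ti; have -> : t = P by apply: subset_card_eq; rewrite // ti iP.
rewrite rdiff_bottom; apply: (forest_kernel_eq0 (pointed_degree0 hA hpointed)
  PQ br _ (xj P)).
  (* With [i = #|P|] the bound reads [j + ncomponents Q < ncomponents P], and each edge of [Q :\: P]
     merges at most two components, so [j < #|Q :\: P|]. *)
  have := ncomponents_setD PQ; rewrite iP -addnA ltn_add2l in ij.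
  by move/(leq_trans ij); rewrite addnC ltn_add2l.
move=> f; rewrite inE => /andP[fP fQ].
apply: (@mulr_sign_eq0 _ _ _ P f); rewrite -rdiff_setU1 //.
apply: xc; first exact: subsetUr.
  by rewrite subUset sub1set fQ.
by rewrite cardsU1 fP iP.
Qed.

(** Both bounds go by one induction: the torsion bound in degree [i.+1] is the vanishing bound in
    degree [i], which [torsion_free_step] requires of the deletion. *)
Lemma relative_vanishing P Q i j : P \subset Q ->
  ((i + j + ncomponents Q < #|P| + ncomponents P)%N -> acyclic A_ P Q i j) /\
  ((i + j + ncomponents Q <= #|P| + ncomponents P)%N ->
     torsion_free A_ P Q i j).
Proof.
have [n] := ubnP #|Q :\: P|; elim: n P Q i => // n IH P Q i QP PQ.
have [/exists_inP[e eQP nbr]|] := boolP [exists e in Q :\: P, ~~ bridge Q e].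
  have [eP eQ] : e \notin P /\ e \in Q by apply/andP; rewrite inE in eQP.
  have QPD : Q :\ e :\: P = (Q :\: P) :\ e by rewrite setDDl setUC -setDDl.
  have QPC : Q :\: (e |: P) = (Q :\: P) :\ e by rewrite setDDl setUC.
  have QPlt : (#|(Q :\: P) :\ e| < n)%N by move: QP; rewrite (cardsD1 e) eQP.
  have PQD : P \subset Q :\ e by rewrite subsetD1 PQ.
  have PQC : e |: P \subset Q by rewrite subUset sub1set eQ.
  have IHD k := IH P (Q :\ e) k; rewrite QPD in IHD.
  have IHC k := IH (e |: P) Q k; rewrite QPC in IHC.
  have kD := ncomponents_setD1 eQ nbr; rewrite kD in IHD.
  (* Contracting [e] adds one edge to [P] and loses at most one component. *)
  have kC : (#|P| + ncomponents P <= #|e |: P| + ncomponents (e |: P))%N.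
    by rewrite cardsU1 eP add1n addSnnS leq_add2l ncomponents_setU1.
  split=> ij.
    apply: (acyclic_step hA eP); first exact: (IHD i QPlt PQD).1.
    by apply: (IHC i QPlt PQC).1; exact: leq_trans ij kC.
  case: i ij => [|i] ij; first exact: torsion_free_below.
  apply: (torsion_free_step hA eP).
  - exact: (IHD i QPlt PQD).1.
  - exact: (IHD i.+1 QPlt PQD).2.
  - by apply: (IHC i.+1 QPlt PQC).2; exact: leq_trans ij kC.
move=> /exists_inPn br; have {}br e : e \in Q :\: P -> bridge Q e.
  by move=> /br; rewrite negbK.
split=> ij; first exact: forest_vanishing.
have [iP|Pi] := leqP i #|P|; first exact: torsion_free_below.
by move=> x y m xj yj m0 xc _; exact: (forest_acyclic hA PQ br Pi).
Qed.

End Vanishing.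

(** * From relative complexes to graph cohomology *)

Section Cochains.
Variables (A : comPzRingType) (A_ : nat -> {pred A}) (G : mgraph).
Local Notation E := 'I_(nedges G).
Local Notation family := (forall s : {set E}, state A s).
Implicit Types (s t : {set E}) (e : E) (i j : nat).

(** Matching on [idP] yields the cardinality proof needed to form the index of [x]. *)
Definition extend i (x : cochain A G i) : family := fun s =>
  if @idP (#|s| == i) is ReflectT si then x (Sub s si) else 0.

Definition restrict i (x : family) : cochain A G i := [ffun s => x (val s)].

Lemma extendE i (x : cochain A G i) (s : edge_sets G i) :
  extend x (val s) = x s.
Proof.
case: s => s si; rewrite /extend /=; case: {-}_ / idP => // si'.
by rewrite (bool_irrelevance si' si).
Qed.

(** In a pair [s], [e] with [t = e |: s] and [e] outside [s], the set [s] must be [t :\ e], so the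
    double sum collapses. *)
Lemma differentialE i (x : cochain A G i) (t : edge_sets G i.+1) :
  differential x t = rdiff set0 (extend x) (val t).
Proof.
rewrite ffunE /rdiff; under [RHS]eq_bigl do rewrite in_set0 andbT.
rewrite (exchange_big_dep (fun e => e \in val t)) /=; last first.
  by move=> s e _ /andP[_ /eqP->]; rewrite setU11.
apply: eq_bigr => e et.
have sE : #|val t :\ e| == i.
  by have /eqP := valP t; rewrite (cardsD1 e) et add1n => -[->].
rewrite (big_pred1 (Sub (val t :\ e) sE)) => [|s] /=.
  by rewrite -(extendE x).
apply/andP/eqP => [[es /eqP tE]|->].
  by apply: val_inj; rewrite /= tE setU1K.
by rewrite /= !inE eqxx setD1K.
Qed.

Lemma rdiff_restrict i (y : family) (t : edge_sets G i.+1) :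
  rdiff set0 y (val t) = differential (restrict i y) t.
Proof.
rewrite differentialE; apply: eq_rdiff => e et _.
have sE : #|val t :\ e| == i.
  by have /eqP := valP t; rewrite (cardsD1 e) et add1n => -[->].
by rewrite -[val t :\ e]/(val (Sub (val t :\ e) sE : edge_sets G i)) extendE ffunE.
Qed.

Lemma homogeneous_extend i j (x : cochain A G i) :
  x \in @cochain_deg A A_ G i j -> homogeneous A_ j (extend x).
Proof.
move=> /forallP xj s.
rewrite /extend; case: {-}_ / (@idP (#|s| == i)) => [si|_]; last exact: rpred0.
exact: (xj (Sub s si)).
Qed.

Lemma cocycle_extend i (z : cocycle A G i) :
  cocycle_on set0 [set: E] i (extend (val z)).
Proof.
move=> t _ _ /eqP ti; rewrite -[t]/(val (Sub t ti : edge_sets G i.+1)).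
rewrite -differentialE; have /eqP -> := valP z.
by rewrite ffunE.
Qed.

Lemma coboundary_restrict i (z : cocycle A G i) y :
  coboundary_on set0 [set: E] i (extend (val z)) y -> z \in @coboundaries A G i.
Proof.
case: i z => [|i] z zy; apply/asboolP => /=.
  apply/ffunP => s; rewrite -extendE zy ?sub0set ?subsetT ?(eqP (valP s)) //.
  by rewrite ffunE rdiff0 // => e; rewrite (cards0_eq (eqP (valP s))) inE.
exists (restrict i y); apply/ffunP => s; rewrite -rdiff_restrict -extendE.
by apply: zy; rewrite ?sub0set ?subsetT // (eqP (valP s)).
Qed.

Lemma coboundary_extend i (z : cocycle A G i) : z \in @coboundaries A G i ->
  exists y, coboundary_on set0 [set: E] i (extend (val z)) y.
Proof.
case: i z => [|i] z /asboolP /= => [z0|[y zy]].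
  exists (fun s => 0) => t _ _ /eqP ti.
  rewrite -[t]/(val (Sub t ti : edge_sets G 0)) extendE z0 ffunE.
  by rewrite rdiff0.
exists (extend y) => t _ _ /eqP ti.
rewrite -[t]/(val (Sub t ti : edge_sets G i.+1)) extendE zy.
exact: differentialE.
Qed.

Lemma extendMn i (x : cochain A G i) n s :
  #|s| = i -> extend (x *+ n) s = extend x s *+ n.
Proof.
move=> /eqP si; rewrite -[s]/(val (Sub s si : edge_sets G i)) !extendE.
by elim: n => [|n IH]; rewrite ?mulr0n ?mulrS ffunE ?IH.
Qed.

Lemma cohomology_class_eq0 i (z : cocycle A G i) :
  (cohomology_class z == 0) = (z \in @coboundaries A G i).
Proof. by rewrite -[z in RHS]subr0 Quotient.idealrBE raddf0. Qed.

Lemma cohomology_classMn i (z : cocycle A G i) n :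
  cohomology_class (z *+ n) = cohomology_class z *+ n.
Proof. exact: raddfMn. Qed.

Hypothesis hA : graded_algebra A_.

(** A primitive given by [coboundaries] may have mixed degree. Applying [tproj], which commutes with
    edge maps and fixes the homogeneous left side, makes it homogeneous. *)
Lemma homogeneous_coboundary i j x y n :
  homogeneous A_ j x -> coboundary_on set0 [set: E] i (fun s => x s *+ n) y ->
  exists2 y', homogeneous A_ j y' &
    coboundary_on set0 [set: E] i (fun s => x s *+ n) y'.
Proof.
move=> xj xy; exists (fun s => tproj hA j (y s)).
  by move=> s; exact: tproj_deg.
move=> t t0 tT ti; rewrite -(tproj_id hA (rpredMn n (xj t))) (xy t t0 tT ti).
rewrite /rdiff raddf_sum; apply: eq_bigr => e _.
by rewrite raddfMz /= /edge_map pushforward_tproj.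
Qed.

End Cochains.

Theorem theorem10 (A : comPzRingType) (A_ : nat -> {pred A})
    (hA : graded_algebra A_) (hpointed : pointed A_)
    (G : mgraph) (v mu : nat)
    (hv : v = #|vertex G|) (hmu : mu = ncomponents [set: 'I_(nedges G)])
    (i j : nat) :
  ((exists h : graph_cohomology A_ G i j, h != 0) ->
     (v - mu <= i + j)%N)
  /\
  ((exists2 h : graph_cohomology A_ G i j,
      h \in torsion (graph_cohomology A_ G i j) & h != 0) ->
     (v - mu + 1 <= i + j)%N).
Proof.
have muv : (mu <= v)%N by rewrite hmu hv ncomponents_vertices.
have vk : (v <= ncomponents (set0 : {set 'I_(nedges G)}))%N.
  by rewrite hv; exact: ncomponents_set0.
have rep (h : graph_cohomology A_ G i j) : exists2 z : cocycle A G i,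
    homogeneous A_ j (extend (val z)) & val h = cohomology_class z.
  have /asboolP[z zj hz] := valP h; exists z => //.
  exact: homogeneous_extend.
(* The full complex is the case where [P] is empty and [Q] contains all edges. *)
have [van tf] := relative_vanishing hA hpointed i j
  (sub0set [set: 'I_(nedges G)]).
rewrite cards0 add0n -hmu in van tf.
split=> [[h]|[h /asboolP[n n0 hn]]]; have [z zj hz] := rep h.
  apply: contraR; rewrite -ltnNge ltn_subRL addnC => /leq_trans/(_ vk)/van ac.
  rewrite -val_eqE /= hz cohomology_class_eq0.
  have [y _ zy] := ac _ zj (cocycle_extend z).
  exact: coboundary_restrict zy.
(* Since [mu <= v], the truncated subtraction is undone by adding [mu]. *)
apply: contraR; rewrite -ltnNge addn1 ltnS -(leq_add2r mu) subnK //.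
move=> /leq_trans/(_ vk)/tf tor; rewrite -val_eqE /= hz cohomology_class_eq0.
have /coboundary_extend[y zny] : z *+ n \in @coboundaries A G i.
  by rewrite -cohomology_class_eq0 cohomology_classMn -hz -raddfMn hn raddf0.
have zny' : coboundary_on set0 setT i (fun s => extend (val z) s *+ n) y.
  move=> t t0 tT ti; rewrite -extendMn // -raddfMn.
  exact: zny.
have [y' yj' zy'] := homogeneous_coboundary hA zj zny'.
have [w _ zw] := tor _ _ n zj yj' n0 (cocycle_extend z) zy'.
exact: coboundary_restrict zw.
Qed.
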